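(* Let $h\in H$, let $f(z)=\sum_{n=0}^{+\infty}a_nz^n$ be analytic in the unit disc $\mathbb{D}$ and not identically zero, and let $(\theta_n)_{n\ge0}$ be a sequence of positive integers such that for some $q>1$ $$\frac{\theta_{n+1}}{\theta_n}\ge q\qquad(n\ge0).$$ For $t\in\mathbb{R}$ put $f_t(z)=\sum_{n=0}^{+\infty}a_ne^{i\theta_nt}z^n$. Then for every $\delta>0$ and for almost every $t\in\mathbb{R}$ (with respect to Lebesgue measure) there exists a measurable set $E(\delta,t)\subset(0,1)$ with $\int_{E(\delta,t)}h(r)\,dr<+\infty$ such that for all $r\in(0,1)\setminus E(\delta,t)$ $$M_f(r,t)\le\mu_f(r)\sqrt{h(r)}\,\ln^{1/4}\{h(r)\mu_f(r)\}\,\ln^{3/4+\delta}h(r)\,\ln_2^{1+\delta}\{h(r)\mu_f(r)\}.$$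
   Context: $H$ is the class of positive continuous functions $h$ on $(0,1)$ increasing to $+\infty$ (as $r\to1-0$) such that $\int_{r_0}^1h(r)\,dr=+\infty$ for $r_0\in(0,1)$. For $r\in(0,1)$: $\mu_f(r)=\max\{|a_n|r^n:n\ge0\}$ and $M_f(r,t)=\max\{|f_t(z)|:|z|\le r\}$. $\ln_2x=\ln\ln x$, and $\ln^{a}x$, $\ln_2^{a}x$ denote $(\ln x)^a$, $(\ln\ln x)^a$. *)

(* Defs.v *)
From HB Require Import structures.
From mathcomp Require Import all_boot all_order all_algebra.
From mathcomp Require Import complex.
From mathcomp Require Import all_classical all_reals all_analysis.

Set Implicit Arguments.
Unset Strict Implicit.
Unset Printing Implicit Defensive.

Import Order.TTheory GRing.Theory Num.Theory.
Import numFieldNormedType.Exports.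

Local Open Scope classical_set_scope.
Local Open Scope ring_scope.
Local Open Scope complex_scope.

(* The complex numbers over [R], packed as a [numClosedFieldType] so that the
   topology that MathComp-Analysis puts on such fields is found on them. *)
Definition C (R : realType) : numClosedFieldType := R[i].

(* [`|z|] takes its values in [C R]; this is the modulus as a real number. *)
Definition cmod (R : realType) (z : C R) : R := ComplexField.Normc.normc z.

(* [exp (i s)] *)
Definition expi (R : realType) (s : R) : C R := cos s +i* sin s.

(* Only the values of [h] on (0,1) are constrained. "Increasing" is read in the
   wide sense (nondecreasing), so that strictly increasing [h] are included. *)
Definition classH (R : realType) (h : R -> R) : Prop :=
  [/\ forall r, 0 < r < 1 -> 0 < h r,
      {within `]0, 1[, continuous h},
      forall r s, 0 < r -> r <= s -> s < 1 -> h r <= h s,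
      h r @[r --> 1^'-] --> +oo &
      forall r0, 0 < r0 < 1 ->
        (\int[lebesgue_measure]_(r in `]r0, 1%R[) (h r)%:E = +oo)%E].

Definition power_series (R : realType) (a : nat -> C R) (z : C R) :
  nat -> C R := series (fun n => a n * z ^+ n).

Definition is_power_sum_on_disc (R : realType) (a : nat -> C R)
    (f : C R -> C R) : Prop :=
  forall z, cmod z < 1 -> power_series a z @ \oo --> f z.

Definition twist (R : realType) (theta : nat -> nat) (a : nat -> C R) (t : R) :
  nat -> C R := fun n => a n * expi ((theta n)%:R * t).

Definition f_t (R : realType) (theta : nat -> nat) (a : nat -> C R) (t : R)
    (z : C R) : C R :=
  limn (power_series (twist theta a t) z).

(* When [a] is the coefficient sequence of a power series converging in the unit
   disc and 0 < r < 1, the two suprema below are over nonempty bounded sets and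
   are attained, so they are the maxima [mu_f r] and [M_f r t]. *)
Definition max_term (R : realType) (a : nat -> C R) (r : R) : R :=
  sup [set cmod (a n) * r ^+ n | n in [set: nat]].

Definition max_modulus (R : realType) (g : C R -> C R) (r : R) : R :=
  sup [set cmod (g z) | z in [set z | cmod z <= r]].

(* [ln] and [powR] are total. Since [h r] and [h r * mu] tend to +oo as r tends
   to 1, all the logarithms involved are positive on some interval (r1, 1); the
   remaining r form the set (0, r1], on which [h] is integrable, so the values
   chosen for [ln] and [powR] outside their natural domain are immaterial to a
   bound holding off a set of finite [h]-measure. *)
Definition wiman_bound (R : realType) (h : R -> R) (mu : R -> R) (delta r : R) :
  R :=
  mu r * Num.sqrt (h r) *
  ln (h r * mu r) `^ (1 / 4) *
  ln (h r) `^ (3 / 4 + delta) *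
  ln (ln (h r * mu r)) `^ (1 + delta).

(* Main.v *)
Require Import Defs.
From HB Require Import structures.
From mathcomp Require Import all_boot all_order all_algebra.
From mathcomp Require Import all_classical all_reals all_analysis.
From mathcomp Require Import measurable_realfun complex zify ring lra.

Set Implicit Arguments.
Unset Strict Implicit.
Unset Printing Implicit Defensive.

Import Order.TTheory GRing.Theory Num.Theory.
Import numFieldNormedType.Exports.

Local Open Scope classical_set_scope.
Local Open Scope ring_scope.

(* Write c_n = |a_n|, g(r) = sum c_n r^n, and let A and V be the mean and the
   variance of the probability on nat with weights c_n r^n / g(r).

   Deterministic part (Wiman-Valiron in Rosenbloom's form).  If u is increasing
   and bounded then u' <= h off a set of finite h-measure; applied to functions
   of ln g and of A this bounds A and V by powers of h and ln g, up to
   logarithms.  By Chebyshev g <= 4 mu (sqrt(2V+2) + 1), which gives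
   sum c_n^2 r^(2n) <= mu g <= mu^2 h ln^(1/2)(h mu) (logarithmic factors).

   Random part.  After splitting n into residue classes mod k with q^k >= 2, the
   frequencies theta_n of each class satisfy theta_j >= 2 theta_i for j > i, so
   Riesz products have constant mean and lacunary cosine sums are subgaussian
   over every interval [-l pi, l pi].  The disc |z| <= r is replaced by a net of
   O(N^2) points, N being polynomial in h and ln g, and a union bound shows that
   for fixed r the bad t in [-l pi, l pi] have measure O(1 / h(r)).  No
   discretization of r is needed: since 1 / h * h is integrable on (0,1), Tonelli
   gives, for almost every t, a bad set of r of finite h-measure. *)

(** * Riesz products *)

(** For x^2 <= 1/2, apply exp y <= 1/(1-y) at x and -x: the mean is at most 1/(1-x^2) <= 1 + 2x^2.
    Otherwise both x and -x are at most 2x^2. *)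
Lemma coshR_le (R : realType) (x : R) :
  (expR x + expR (- x)) / 2 <= expR (2 * x ^+ 2).
Proof.
have exp_le_inv (y : R) : y < 1 -> expR y <= (1 - y)^-1.
  move=> y1; have h1 : 0 < 1 - y by lra.
  rewrite -[expR y]invrK -expRN lef_pV2 ?posrE ?expR_gt0//.
  exact: expR_ge1Dx.
have [x2|x2] := leP (x ^+ 2) 2^-1.
  have x1 : x < 1 by nra.
  have xN1 : - x < 1 by nra.
  have := exp_le_inv _ x1; have := exp_le_inv _ xN1.
  rewrite opprK => h1 h2.
  have := expR_ge1Dx (2 * x ^+ 2).
  apply: le_trans.
  have p1 : 0 < 1 - x by lra.
  have p2 : 0 < 1 + x by lra.
  have p3 : 0 < (1 - x) * (1 + x) by exact: mulr_gt0.
  have -> : 1 + 2 * x ^+ 2 = ((1 + 2 * x ^+ 2) * ((1 - x) * (1 + x))) / ((1 - x) * (1 + x)).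
    by rewrite mulfK// gt_eqF.
  apply: (@le_trans _ _ (((1 - x)^-1 + (1 + x)^-1) / 2)); first by lra.
  have -> : ((1 - x)^-1 + (1 + x)^-1) / 2 = 1 / ((1 - x) * (1 + x)).
    by field; rewrite !gt_eqF.
  by rewrite ler_pM2r ?invr_gt0//; nra.
have h1 : x <= 2 * x ^+ 2 by nra.
have h2 : - x <= 2 * x ^+ 2 by nra.
rewrite -ler_expR in h1; rewrite -ler_expR in h2; lra.
Qed.

(** Convexity: exp lies below its chord over [-rho, rho]. An affine majorant turns the exponential
    of a sum of cosines into a product of trigonometric factors, that is, a Riesz product. *)
Lemma expR_le_chord (R : realType) (rho x : R) : 0 <= rho -> `|x| <= rho ->
  expR x <= (expR rho + expR (- rho)) / 2
            + (expR rho - expR (- rho)) / (2 * rho) * x.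
Proof.
rewrite le_eqVlt => /predU1P[<-|r0].
  by rewrite normr_le0 => /eqP ->; rewrite !mulr0 oppr0 expR0; lra.
rewrite ler_norml => /andP[x1 x2].
have r2 : rho != 0 by rewrite gt_eqF.
pose t := (x + rho) / (2 * rho).
have t01 : 0 <= t <= 1.
  rewrite /t divr_ge0 ?ler_pdivrMr; lra.
have xE : x = t * rho + (1 - t) * (- rho) by rewrite /t; field.
have -> : (expR rho + expR (- rho)) / 2
            + (expR rho - expR (- rho)) / (2 * rho) * x
  = t * expR rho + (1 - t) * expR (- rho) by rewrite /t; field.
(* Convexity is used through the tangent at x: its values at rho and -rho, averaged with weights t
   and 1 - t, give exp x. *)
have tang (y : R) : expR x * (1 + (y - x)) <= expR y.
  have -> : expR y = expR x * expR (y - x) by rewrite -expRD subrKC.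
  by rewrite ler_pM2l ?expR_gt0// expR_ge1Dx.
have := tang rho; have := tang (- rho).
move: t01 => /andP[t0 t1] h1 h2.
have h3 := ler_wpM2l t0 h2.
have t1' : 0 <= 1 - t by lra.
have h4 := ler_wpM2l t1' h1.
have {1}-> : expR x = t * (expR x * (1 + (rho - x)))
    + (1 - t) * (expR x * (1 + (- rho - x))).
  rewrite [RHS](_ : _ = expR x * (1 + (t * rho + (1 - t) * (- rho)) - x)); last by ring.
  by rewrite -xE; ring.
exact: lerD.
Qed.

(* A continuous function on [[-p, p]] given by an antiderivative showing that
   its integral over [[-p, p]] vanishes. *)
Definition mean_zero (R : realType) (p : R) (u : R -> R) :=
  exists2 F : R -> R, (forall t : R, is_derive t (1 : R) F (u t)) & F p = F (- p).

Lemma mean_zeroD (R : realType) (p : R) u v :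
  mean_zero p u -> mean_zero p v -> mean_zero p (fun t => u t + v t).
Proof.
move=> [F dF Fp] [G dG Gp]; exists (fun t => F t + G t); last by rewrite Fp Gp.
by move=> t; apply: is_deriveD.
Qed.

Lemma mean_zeroZ (R : realType) (p : R) a u :
  mean_zero p u -> mean_zero p (fun t => a * u t).
Proof.
move=> [F dF Fp]; exists (fun t => a * F t); last by rewrite Fp.
by move=> t; apply: is_deriveZ.
Qed.

Lemma mean_zero_ext (R : realType) (p : R) (u v : R -> R) :
  mean_zero p u -> (forall t, u t = v t) -> mean_zero p v.
Proof. by move=> H /funext <-. Qed.

Lemma sin_natpi (R : realType) n : sin (n%:R * pi) = 0 :> R.
Proof.
elim: n => [|n IH]; first by rewrite mul0r sin0.
by rewrite -natr1 mulrDl mul1r sinDpi IH oppr0.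
Qed.

Lemma is_derive_mulnat (R : realType) (c t : R) : is_derive t (1 : R) (fun t => c * t) c.
Proof. by rewrite -[X in is_derive _ _ _ X]mulr1; apply: is_deriveZ. Qed.

Lemma mean_zero_cos (R : realType) (l n : nat) : (0 < n)%N ->
  mean_zero (l%:R * pi) (fun t : R => cos (n%:R * t)).
Proof.
move=> n0; have n0' : n%:R != 0 :> R by rewrite pnatr_eq0 -lt0n.
exists (fun t => n%:R^-1 * sin (n%:R * t)); last first.
  by rewrite mulrN sinN mulrA -natrM sin_natpi oppr0.
move=> t; have := is_derive_mulnat n%:R t => d1.
have d2 : is_derive t (1 : R) (fun t => sin (n%:R * t)) (cos (n%:R * t) * n%:R).
  by apply: (is_derive1_comp (f := sin)).
have := @is_deriveZ _ _ _ _ n%:R^-1 _ _ _ d2.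
by rewrite /GRing.scale/= mulrC mulfK.
Qed.

Lemma mean_zero_sin (R : realType) (l n : nat) : (0 < n)%N ->
  mean_zero (l%:R * pi) (fun t : R => sin (n%:R * t)).
Proof.
move=> n0; have n0' : n%:R != 0 :> R by rewrite pnatr_eq0 -lt0n.
exists (fun t => (- n%:R^-1) * cos (n%:R * t)); last first.
  by rewrite (mulrN n%:R) cosN.
move=> t; have := is_derive_mulnat n%:R t => d1.
have d2 : is_derive t (1 : R) (fun t => cos (n%:R * t)) (- sin (n%:R * t) * n%:R).
  by apply: (is_derive1_comp (f := cos)).
have := @is_deriveZ _ _ _ _ (- n%:R^-1) _ _ _ d2.
by rewrite /GRing.scale/= mulNr mulNr mulrN opprK mulrC mulfK.
Qed.

(* [T] has no Fourier coefficient of frequency above [d]. *)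
Definition spectrum_le (R : realType) (p : R) (d : nat) (T : R -> R) :=
  forall n, (d < n)%N -> mean_zero p (fun t => T t * cos (n%:R * t)) /\
                         mean_zero p (fun t => T t * sin (n%:R * t)).

(** By the product-to-sum formulas, testing against frequency n becomes testing T against n, n - e
    and n + e, all above d when n > d + e. *)
Lemma spectrum_le_mul (R : realType) (p : R) d e T (A a b : R) : (d < e)%N ->
  spectrum_le p d T ->
  spectrum_le p (d + e)
    (fun t => T t * (A + (a * cos (e%:R * t) + b * sin (e%:R * t)))).
Proof.
move=> de sT n den.
have le1 : (d < n)%N by apply: leq_ltn_trans den; rewrite leq_addr.
have le2 : (d < n - e)%N by rewrite ltn_subRL addnC.
have le3 : (d < n + e)%N by rewrite (leq_trans le1)// leq_addr.
have [c0 s0] := sT _ le1; have [cm sm] := sT _ le2; have [cp sp] := sT _ le3.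
have nmE t : (n - e)%:R * t = n%:R * t - e%:R * t :> R.
  rewrite natrB ?mulrBl//; apply: leq_trans (ltnW den); exact: leq_addl.
have npE t : (n + e)%:R * t = n%:R * t + e%:R * t :> R by rewrite natrD mulrDl.
split.
- have := (mean_zeroD (mean_zeroZ A c0) (mean_zeroD
    (mean_zeroD (mean_zeroZ (a / 2) cm) (mean_zeroZ (a / 2) cp))
    (mean_zeroD (mean_zeroZ (b / 2) sp) (mean_zeroZ (- b / 2) sm)))).
  move=> /mean_zero_ext; apply => t /=.
  rewrite !nmE !npE cosB cosD sinB sinD; by field.
- have := (mean_zeroD (mean_zeroZ A s0) (mean_zeroD
    (mean_zeroD (mean_zeroZ (a / 2) sm) (mean_zeroZ (a / 2) sp))
    (mean_zeroD (mean_zeroZ (- b / 2) cp) (mean_zeroZ (b / 2) cm)))).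
  move=> /mean_zero_ext; apply => t /=.
  rewrite !nmE !npE cosB cosD sinB sinD; by field.
Qed.

Lemma spectrum_le1 (R : realType) (l : nat) :
  spectrum_le (l%:R * pi : R) 0 (fun=> 1).
Proof.
move=> n n0; split.
  by have := mean_zero_cos R l n0; move=> /mean_zero_ext; apply => t; rewrite mul1r.
by have := mean_zero_sin R l n0; move=> /mean_zero_ext; apply => t; rewrite mul1r.
Qed.

Section riesz.
Variables (R : realType) (l : nat) (theta : nat -> nat) (P : pred nat).
Hypothesis theta_gt0 : forall n, (0 < theta n)%N.
Hypothesis theta2 : forall i n, P i -> P n -> (i < n)%N ->
  (2 * theta i <= theta n)%N.

Let S N := (\sum_(i < N | P i) theta i)%N.

(** As for powers of 2, doubling makes each frequency exceed the sum of all earlier ones; hence a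
    new factor oscillates above the whole spectrum of the partial product. *)
Let S_lt N n : P n -> (N <= n)%N -> (S N < theta n)%N.
Proof.
elim: N n => [|N IH] n Pn Nn; first by rewrite /S big_ord0.
rewrite /S big_mkcond big_ord_recr/= -big_mkcond/= -/(S N).
case: ifPn => PN; last by rewrite addn0 IH// ltnW.
by apply: leq_trans (theta2 PN Pn Nn); rewrite mul2n -addnn ltn_add2r IH.
Qed.

Variables A a b : nat -> R.

Let fac i t := A i + (a i * cos ((theta i)%:R * t) + b i * sin ((theta i)%:R * t)).

(** Induction on N: the oscillating part of factor N has frequency above [S N], so it is orthogonal
    to the previous product, and only the constant [A N] contributes to the mean. *)
Lemma riesz_product N :
  spectrum_le (l%:R * pi) (S N) (fun t => \prod_(i < N | P i) fac i t) /\
  mean_zero (l%:R * pi) (fun t => \prod_(i < N | P i) fac i t - \prod_(i < N | P i) A i).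
Proof.
elim: N => [|N [IH1 IH2]].
  split.
    rewrite (_ : (fun t => _) = fun=> 1); last by apply/funext => t; rewrite big_ord0.
    by rewrite /S big_ord0; exact: spectrum_le1.
  exists (fun=> 0) => // t; rewrite !big_ord0 subrr; exact: is_derive_cst.
have prE (F : nat -> R) : \prod_(i < N.+1 | P i) F i =
    (\prod_(i < N | P i) F i) * (if P N then F N else 1).
  by rewrite big_mkcond big_ord_recr/= -big_mkcond.
have SE : S N.+1 = (S N + (if P N then theta N else 0))%N.
  by rewrite /S big_mkcond big_ord_recr/= -big_mkcond.
under eq_fun do rewrite (prE (fac ^~ _)).
under [X in mean_zero _ X]eq_fun do rewrite (prE (fac ^~ _)) prE.
rewrite SE; case: ifPn => PN; last first.
  rewrite addn0; split.
    by under eq_fun do rewrite mulr1.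
  by under eq_fun do rewrite !mulr1.
have SN : (S N < theta N)%N by exact: S_lt.
split; first exact: spectrum_le_mul.
have [cN sN] := IH1 _ SN.
have := mean_zeroD (mean_zeroZ (A N) IH2)
  (mean_zeroD (mean_zeroZ (a N) cN) (mean_zeroZ (b N) sN)).
move=> /mean_zero_ext; apply => t /=.
rewrite /fac; ring.
Qed.

End riesz.

Lemma integral_is_derive (R : realType) (f F : R -> R) (a b : R) : a < b ->
  (forall x, a <= x <= b -> is_derive x (1 : R) F (f x)) ->
  (forall x, a <= x <= b -> {for x, continuous f}) ->
  (\int[lebesgue_measure]_(x in `[a, b]) (f x)%:E = (F b - F a)%:E)%E.
Proof.
move=> ab dF cf.
have cF x : a <= x <= b -> {for x, continuous F}.
  move=> /dF d; apply: differentiable_continuous; apply/derivable1_diffP.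
  exact: ex_derive.
rewrite EFinB; apply: continuous_FTC2 => //.
- apply: continuous_in_subspaceT => x; rewrite inE/= in_itv/= => xab.
  exact: cf.
- split.
  + move=> x; rewrite in_itv/= => /andP[ax xb].
    have d : is_derive x 1 F (f x) by apply: dF; rewrite !ltW.
    exact: ex_derive.
  + apply: cvg_at_right_filter; apply: cF; rewrite lexx ltW//.
  + apply: cvg_at_left_filter; apply: cF; rewrite lexx ltW//.
- move=> x; rewrite in_itv/= => /andP[ax xb].
  rewrite derive1E.
  have d : is_derive x 1 F (f x) by apply: dF; rewrite !ltW.
  exact: derive_val.
Qed.

Lemma continuous_trig (R : realType) (n : nat) (a b : R) :
  continuous (fun t : R => a * cos (n%:R * t) + b * sin (n%:R * t)).
Proof.
move=> t.
have lin : n%:R * x @[x --> t] --> n%:R * t.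
  by apply: cvgM; [exact: cvg_cst|exact: cvg_id].
apply: cvgD; apply: cvgM; try exact: cvg_cst.
  exact: (cvg_comp _ _ lin (@continuous_cos R (n%:R * t))).
exact: (cvg_comp _ _ lin (@continuous_sin R (n%:R * t))).
Qed.

Lemma continuous_sum (R : realType) (I : Type) (s : seq I) (P : pred I)
    (f : I -> R -> R) : (forall i, continuous (f i)) ->
  continuous (fun t => \sum_(i <- s | P i) f i t).
Proof.
move=> cf t; elim: s => [|i s IH].
  under eq_fun do rewrite big_nil; exact: cvg_cst.
rewrite /continuous_at big_cons; under eq_fun do rewrite big_cons.
by case: ifP => _ //; apply: cvgD => //; exact: cf.
Qed.

Lemma continuous_prod (R : realType) (I : Type) (s : seq I) (P : pred I)
    (f : I -> R -> R) : (forall i, continuous (f i)) ->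
  continuous (fun t => \prod_(i <- s | P i) f i t).
Proof.
move=> cf t; elim: s => [|i s IH].
  under eq_fun do rewrite big_nil; exact: cvg_cst.
rewrite /continuous_at big_cons; under eq_fun do rewrite big_cons.
by case: ifP => _ //; apply: cvgM => //; exact: cf.
Qed.

Lemma trig_amplitude (R : realType) (a b x rho : R) : 0 <= rho ->
  a ^+ 2 + b ^+ 2 <= rho ^+ 2 -> `|a * cos x + b * sin x| <= rho.
Proof.
move=> r0 ab; rewrite -(ler_pXn2r (n := 2)) ?nnegrE//.
apply: le_trans ab; rewrite real_normK ?num_real//.
rewrite -[leRHS]mulr1 -(cos2Dsin2 x) -subr_ge0.
(* Lagrange's identity, the equality form of Cauchy-Schwarz. *)
rewrite (_ : _ - _ = (a * sin x - b * cos x) ^+ 2) ?sqr_ge0//; ring.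
Qed.

(** * Exponential moments of lacunary cosine sums *)

Section subgaussian.
Variables (R : realType) (l : nat) (theta : nat -> nat) (P : pred nat).
Hypothesis l_gt0 : (0 < l)%N.
Hypothesis theta_gt0 : forall n, (0 < theta n)%N.
Hypothesis theta2 : forall i n, P i -> P n -> (i < n)%N ->
  (2 * theta i <= theta n)%N.
Variables a b rho : nat -> R.
Hypothesis rho_ge0 : forall i, 0 <= rho i.
Hypothesis ab_le : forall i, a i ^+ 2 + b i ^+ 2 <= rho i ^+ 2.

Let p : R := l%:R * pi.

(** The chord bound replaces each exponential factor by [fac i], with constant term cosh(rho_i). The
    resulting Riesz product has mean prod cosh(rho_i), which [coshR_le] bounds by exp(2 sum
    rho_i^2). *)
Lemma integral_exp_trig_le N :
  (\int[lebesgue_measure]_(t in `[(- p)%R, p])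
     (expR (\sum_(i < N | P i)
        (a i * cos ((theta i)%:R * t) + b i * sin ((theta i)%:R * t))))%:E
   <= (2 * p * expR (2 * \sum_(i < N) rho i ^+ 2))%:E)%E.
Proof.
have p0 : 0 < p by rewrite mulr_gt0 ?ltr0n ?pi_gt0.
have pp : - p < p by lra.
pose A i := (expR (rho i) + expR (- rho i)) / 2.
pose d i := (expR (rho i) - expR (- rho i)) / (2 * rho i).
pose fac i t := A i + (d i * a i * cos ((theta i)%:R * t)
                       + d i * b i * sin ((theta i)%:R * t)).
pose T N t := \prod_(i < N | P i) fac i t.
have A0 i : 0 <= A i by rewrite divr_ge0// addr_ge0// expR_ge0.
have ler i t : expR (a i * cos ((theta i)%:R * t) + b i * sin ((theta i)%:R * t))
    <= fac i t.
  have := expR_le_chord (rho_ge0 i)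
    (trig_amplitude ((theta i)%:R * t) (rho_ge0 i) (ab_le i)).
  by rewrite /fac -/(A i) -/(d i) mulrDr !mulrA.
have cT : continuous (T N).
  apply: continuous_prod => i; rewrite /fac => t.
  by apply: cvgD; [exact: cvg_cst|exact: continuous_trig].
have cE : continuous (fun t : R => expR (\sum_(i < N | P i)
        (a i * cos ((theta i)%:R * t) + b i * sin ((theta i)%:R * t)))).
  move=> t; apply: cvg_comp; last exact: continuous_expR.
  exact: (continuous_sum (f := fun (i : 'I_N) (t : R) =>
    a i * cos ((theta i)%:R * t) + b i * sin ((theta i)%:R * t))
    (fun i => @continuous_trig R (theta i) (a i) (b i))).
apply: (@le_trans _ _ (\int[lebesgue_measure]_(t in `[(- p)%R, p]) (T N t)%:E)%E).
  apply: ge0_le_integral => //=.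
  - apply/measurable_EFinP; apply: measurable_funTS.
    exact: continuous_measurable_fun.
  - apply/measurable_EFinP; apply: measurable_funTS.
    exact: continuous_measurable_fun.
  - move=> t _; rewrite lee_fin expR_sum; apply: ler_prod => i _.
    by rewrite expR_ge0/= ler.
have [_ [F dF Fp]] := riesz_product l theta_gt0 theta2 A
  (fun i => d i * a i) (fun i => d i * b i) N.
pose M := \prod_(i < N | P i) A i.
have dG x : - p <= x <= p -> is_derive x (1 : R) (fun t => F t + M * t) (T N x).
  move=> _; have dx := dF x.
  rewrite (_ : T N x = (T N x - M) + M); last by rewrite subrK.
  apply: is_deriveD; exact: is_derive_mulnat.
rewrite (integral_is_derive pp dG); last by move=> x _; exact: cT.
rewrite lee_fin -/p Fp.
rewrite (_ : _ - _ = 2 * p * M); last by ring.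
rewrite ler_pM2l; last exact: mulr_gt0.
rewrite mulr_sumr expR_sum /M big_mkcond/=.
apply: ler_prod => i _; case: ifP => _; first by rewrite A0 coshR_le.
rewrite ler01/= -expR0 ler_expR mulr_ge0 ?sqr_ge0//.
Qed.

End subgaussian.

(** * Sets of finite h-measure *)

Definition finite_integral_on (R : realType) (h : R -> R) (E : set R) :=
  [/\ measurable E, E `<=` `]0, 1[ &
      (\int[lebesgue_measure]_(r in E) (h r)%:E < +oo)%E].

Section finite_integral_on_theory.
Variables (R : realType) (h : R -> R).
Hypothesis mh : measurable_fun (`]0, 1[ : set R) h.
Hypothesis h_gt0 : forall r, 0 < r < 1 -> 0 < h r.

Lemma finite_integral_on_setU A B : finite_integral_on h A ->
  finite_integral_on h B -> finite_integral_on h (A `|` B).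
Proof.
move=> [mA A01 fA] [mB B01 fB].
have AB01 : A `|` B `<=` `]0, 1[ by rewrite subUset.
have mhE (E : set R) : measurable E -> E `<=` `]0, 1[ ->
    measurable_fun E (EFin \o h).
  by move=> mE E01; apply/measurable_EFinP; exact: measurable_funS mh.
have hE0 (E : set R) : E `<=` `]0, 1[ -> forall x, E x -> (0 <= (h x)%:E)%E.
  by move=> E01 x /E01; rewrite /= in_itv/= => /h_gt0 /ltW; rewrite lee_fin.
split => //; first exact: measurableU.
have -> : A `|` B = A `|` (B `\` A) by rewrite setUDr setDv setD0.
have BA01 : A `|` (B `\` A) `<=` `]0, 1[.
  by move=> x [/A01//|[/B01]].
rewrite ge0_integral_setU//=.
- apply: lte_add_pinfty => //; apply: le_lt_trans fB.
  apply: ge0_subset_integral => //=; first exact: measurableD.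
  + exact: mhE.
  + exact: hE0.
- exact: measurableD.
- by apply: mhE => //; apply: measurableU => //; exact: measurableD.
- exact: hE0.
- by rewrite disj_set2E setDIK.
Qed.

Lemma finite_integral_on_itv (s : R) : s < 1 ->
  (forall r s, 0 < r -> r <= s -> s < 1 -> h r <= h s) ->
  finite_integral_on h `]0, s].
Proof.
move=> s1 hmono.
have S01 : `]0, s] `<=` `]0, 1[.
  by move=> x; rewrite /= !in_itv/= => /andP[-> /le_lt_trans ->].
split => //.
have m1 : measurable_fun (`]0, s] : set R) (EFin \o h).
  by apply/measurable_EFinP; exact: measurable_funS mh.
apply: (@le_lt_trans _ _ (\int[lebesgue_measure]_(r in `]0%R, s]) (cst (h s)%:E r))%E).
  apply: ge0_le_integral => //=.
  - move=> x /S01; rewrite /= in_itv/= => /h_gt0 /ltW; by rewrite lee_fin.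
  - move=> x; rewrite in_itv/= => /andP[x0 xs]; rewrite lee_fin.
    exact: hmono.
rewrite integral_cst//= lebesgue_measure_itv/=.
by case: ifPn => _; rewrite ?mule0 -?EFinB -?EFinM ltry.
Qed.

(* Borel-Nevanlinna: on the exceptional set h < u', and u' is integrable. *)
Lemma derivative_le_except (u u' : R -> R) (s M : R) : 0 <= s -> s < 1 ->
  (forall r, s < r < 1 -> is_derive r (1 : R) u (u' r)) ->
  (forall r, s < r < 1 -> {for r, continuous u'}) ->
  (forall r, s < r < 1 -> 0 <= u' r) ->
  (forall r, s < r < 1 -> `|u r| <= M) ->
  finite_integral_on h [set r | s < r < 1 /\ h r < u' r].
Proof.
move=> s0 s1 du cu u'0 uM.
pose D : set R := `]s, 1[%classic.
have D01 : D `<=` `]0, 1[.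
  by move=> x; rewrite /D/= !in_itv/= => /andP[/(le_lt_trans s0) -> ->].
have mD : measurable D by exact: measurable_itv.
have mhD : measurable_fun D h by exact: measurable_funS mh.
have mu : measurable_fun D u'.
  apply: open_continuous_measurable_fun.
  - exact: interval_open.
  - by move=> x; rewrite inE /D/= in_itv/=; exact: cu.
pose E := [set r | s < r < 1 /\ h r < u' r].
have ED : E `<=` D by move=> x []; rewrite /D /= in_itv.
have mE : measurable E.
  have := measurable_fun_ltr mhD mu.
  move=> /(_ (measurable_itv _) [set true] I).
  by congr (measurable _).
split => //; [by move=> x /ED/D01|].
have mhE : measurable_fun E h by exact: measurable_funS mhD.
have muE : measurable_fun E u' by exact: measurable_funS mu.
apply: (@le_lt_trans _ _ (\int[lebesgue_measure]_(r in E) (u' r)%:E)%E).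
  apply: ge0_le_integral => //=.
  - move=> x /ED/D01; rewrite /= in_itv/= => /h_gt0 /ltW; by rewrite lee_fin.
  - exact/measurable_EFinP.
  - exact/measurable_EFinP.
  - by move=> x [_]; rewrite lee_fin => /ltW.
apply: (@le_lt_trans _ _ (\int[lebesgue_measure]_(r in D) (u' r)%:E)%E).
  apply: ge0_subset_integral => //=; first exact/measurable_EFinP.
pose w := 1 - s.
have w0 : 0 < w by rewrite /w; lra.
(* The differentiability of u is known only inside ]s, 1[, so this interval is exhausted by compact
   ones. The 3 gives 2 e_n < w, so none of them is degenerate. *)
pose e (n : nat) : R := w / n.+3%:R.
have e0 n : 0 < e n by rewrite divr_gt0.
have ew n : e n + e n < w.
  rewrite -mulrDl ltr_pdivrMr// -[w + w]/(w *+ 2) -mulr_natr ltr_pM2l// ltr_nat//.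
have ehomo m n : (m <= n)%N -> e n <= e m.
  by move=> mn; rewrite ler_pM2l// lef_pV2 ?posrE// ler_nat !ltnS.
pose F n : set R := `[s + e n, 1 - e n]%classic.
have FD n : F n `<=` D.
  move=> x; rewrite /F/D/= !in_itv/= => /andP[x1 x2].
  by have := e0 n; lra.
have DF : D = \bigcup_n F n.
  apply/seteqP; split => [x|x [n _ /FD]//].
  rewrite /D/= in_itv/= => /andP[sx x1].
  pose d := Num.min (x - s) (1 - x).
  have d0 : 0 < d by rewrite lt_min; apply/andP; split; lra.
  pose n := Num.truncn (w / d).
  exists n => //; rewrite /F/= in_itv/=.
  have : e n <= d.
    rewrite /e ler_pdivrMr// mulrC -ler_pdivrMr//.
    apply: ltW; apply: (lt_le_trans (truncnS_gt _)).
    by rewrite ler_nat ltnS leqW.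
  by rewrite le_min => /andP[]; lra.
have muF n : measurable_fun (F n) (fun r => (u' r)%:E).
  by apply/measurable_EFinP; exact: measurable_funS mu.
have u'F n x : F n x -> (0 <= (u' x)%:E)%E.
  by move=> /FD; rewrite /D/= in_itv/= lee_fin => /u'0.
have ndF : nondecreasing_seq F.
  move=> m n mn; apply/subsetPset => x; rewrite /F/= !in_itv/= => /andP[x1 x2].
  by have := ehomo _ _ mn; lra.
(* The integral is a difference of two values of u, so the bound is uniform in n and survives
   monotone convergence. *)
have IF n : (\int[lebesgue_measure]_(r in F n) (u' r)%:E <= (2 * M)%:E)%E.
  have ab : s + e n < 1 - e n by have := ew n; rewrite /w; lra.
  have sub x : s + e n <= x <= 1 - e n -> s < x < 1.
    by have := e0 n; lra.
  have dF x : s + e n <= x <= 1 - e n -> is_derive x (1 : R) u (u' x).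
    by move=> /sub; exact: du.
  rewrite (integral_is_derive ab dF); last by move=> x /sub; exact: cu.
  rewrite lee_fin; apply: le_trans (ler_norm _) _.
  apply: le_trans (ler_normB _ _) _.
  have h3 : `|u (s + e n)| <= M by apply: uM; apply: sub; rewrite lexx ltW.
  have h4 : `|u (1 - e n)| <= M by apply: uM; apply: sub; rewrite lexx ltW.
  lra.
rewrite [X in (\int[_]_(r in X) _)%E]DF.
have := ge0_nondecreasing_set_cvg_integral ndF (fun n => measurable_itv _) muF u'F
  (mu := lebesgue_measure).
move=> /cvg_lim <-//; apply: le_lt_trans (ltry (2 * M)).
apply: lime_le.
  apply: ereal_nondecreasing_is_cvgn.
  move=> m n mn; apply: ge0_subset_integral.
  - exact: measurable_itv.
  - exact: measurable_itv.
  - exact: muF.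
  - exact: u'F.
  - by apply/subsetPset; exact: ndF.
by apply: nearW => n; exact: IF.
Qed.

End finite_integral_on_theory.

(** * Random trigonometric sums *)

(** The double integral is at most M times the measure of D, which is at most 1; after exchanging
    the order, a function of t with finite integral is finite almost everywhere. *)
Lemma tonelli_ae_lt_pinfty (R : realType) (D T : set R) (F : R * R -> R) (M : R) :
  measurable D -> D `<=` `]0, 1[ -> measurable T ->
  measurable_fun setT F -> (forall z, 0 <= F z) ->
  (forall r, D r ->
    (\int[lebesgue_measure]_(t in T) (F (r, t))%:E <= M%:E)%E) ->
  {ae lebesgue_measure, forall t : R, T t ->
     (\int[lebesgue_measure]_(r in D) (F (r, t))%:E < +oo)%E}.
Proof.
move=> mD D01 mT mF F0 FM.
pose G := (EFin \o F) \_ (D `*` T).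
have mG : measurable_fun setT G.
  apply/(measurable_restrictT _ _).1; first exact: measurableX.
  by apply/measurable_EFinP; exact: measurable_funTS.
have G0 z : (0 <= G z)%E.
  by rewrite /G patchE; case: ifPn => //; rewrite lee_fin.
have GE1 r : D r -> (\int[lebesgue_measure]_t G (r, t) =
    \int[lebesgue_measure]_(t in T) (F (r, t))%:E)%E.
  move=> Dr; rewrite [RHS]integral_mkcond; apply: eq_integral => t _.
  by rewrite /G !patchE in_setX mem_set.
have GE2 t : T t -> (\int[lebesgue_measure]_r G (r, t) =
    \int[lebesgue_measure]_(r in D) (F (r, t))%:E)%E.
  move=> Tt; rewrite [RHS]integral_mkcond; apply: eq_integral => r _.
  by rewrite /G !patchE in_setX (mem_set Tt) andbT.
pose H t := (\int[lebesgue_measure]_r G (r, t))%E.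
have mH : measurable_fun setT H.
  exact: (measurable_fun_fubini_tonelli_G (m1 := lebesgue_measure) _ mG G0).
have H0 t : (0 <= H t)%E by apply: integral_ge0.
have iH : (\int[lebesgue_measure]_t H t < +oo)%E.
  have E1 := fubini_tonelli1 (m1 := lebesgue_measure) (m2 := lebesgue_measure) _ mG G0.
  have E2 := fubini_tonelli2 (m1 := lebesgue_measure) (m2 := lebesgue_measure) _ mG G0.
  rewrite [ltLHS](_ : _ = \int[lebesgue_measure]_r fubini_F lebesgue_measure G r)%E;
    last exact: etrans (esym E2) E1.
  apply: (@le_lt_trans _ _ (\int[lebesgue_measure]_(r in D) (cst M%:E) r)%E).
    rewrite [leRHS]integral_mkcond; apply: ge0_le_integral => //=.
    - by move=> r _; apply: integral_ge0.
    - exact: (measurable_fun_fubini_tonelli_F (m2 := lebesgue_measure) _ mG G0).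
    - by apply/(measurable_restrictT _ _).1 => //; exact: measurable_cst.
    - move=> r _; rewrite patchE; case: ifPn => [/set_mem Dr|Dr].
        by rewrite /fubini_F GE1//; exact: FM.
      rewrite /fubini_F integral0_eq// => t _.
      by rewrite /G patchE in_setX (negbTE Dr).
  rewrite integral_cst//.
  have D1 : (lebesgue_measure D <= 1%:E)%E.
    have m01 : (lebesgue_measure (`]0%R, 1%R[%classic : set R) = 1%:E)%E.
      by rewrite lebesgue_measure_itv/= lte_fin ltr01 oppr0 adde0.
    by rewrite -m01; apply: le_measure => //; rewrite inE.
  have := ge0_fin_numE (measure_ge0 lebesgue_measure D).
  rewrite (le_lt_trans D1 (ltry _)) => /fineK <-.
  by rewrite -EFinM ltry.
have intH : lebesgue_measure.-integrable setT H.
  apply/integrableP; split => //.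
  by under eq_integral do rewrite gee0_abs//.
have := integrable_ae measurableT intH.
apply: filterS => t /(_ I) fH Tt.
by rewrite -GE2// -/(H t) -ge0_fin_numE.
Qed.

Lemma measurable_fun_bigsum d (T : measurableType d) (R : realType) (I : Type)
    (s : seq I) (P : pred I) (f : I -> T -> R) :
  (forall i, measurable_fun setT (f i)) ->
  measurable_fun setT (fun t => \sum_(i <- s | P i) f i t).
Proof.
move=> mf; elim: s => [|i s IH].
  under eq_fun do rewrite big_nil; exact: measurable_cst.
under eq_fun do rewrite big_cons.
by case: (P i) => //; exact: measurable_funD.
Qed.

(** Sublevel sets of the integer part are preimages of open rays. The level sets will cut the plane
    into pieces on which the length of the random sums is constant. *)
Lemma measurable_truncn_preimage d (T : measurableType d) (R : realType)
    (X : T -> R) (n : nat) : measurable_fun setT X ->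
  measurable [set x | Num.truncn (X x) = n].
Proof.
move=> mX.
have mle m : measurable [set x | (Num.truncn (X x) <= m)%N].
  have -> : [set x | (Num.truncn (X x) <= m)%N] = X @^-1` `]-oo, m.+1%:R[.
    by apply/seteqP; split => x /=; rewrite in_itv/= truncn_le_nat.
  by rewrite -[X in measurable X]setTI; exact: mX.
case: n => [|n].
  rewrite (_ : [set x | _] = [set x | (Num.truncn (X x) <= 0)%N])//.
  by apply/seteqP; split => x /=; rewrite leqn0 => /eqP.
rewrite (_ : [set x | _] = [set x | (Num.truncn (X x) <= n.+1)%N] `\`
    [set x | (Num.truncn (X x) <= n)%N]); first exact: measurableD.
apply/seteqP; split => x /=.
  by move=> ->; rewrite ltnn; split.
by move=> [h1 /negP]; rewrite -ltnNge => h2; apply/eqP; rewrite eqn_leq h1.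
Qed.

(** * Chernoff bounds and the random exceptional set *)

Section random_bound.
Variables (R : realType) (h X : R -> R) (D : set R) (theta : nat -> nat).
Variables (c : nat -> R) (J : nat -> nat) (P : nat -> nat -> pred nat).
Variables (a b : nat -> nat -> nat -> R).
Hypothesis mh : measurable_fun setT h.
Hypothesis mX : measurable_fun setT X.
Hypothesis mD : measurable D.
Hypothesis D01 : D `<=` `]0, 1[.
Hypothesis h_gt1 : forall r, D r -> 1 < h r.
Hypothesis theta_gt0 : forall n, (0 < theta n)%N.
Hypothesis theta2 : forall n j i k, P n j i -> P n j k -> (i < k)%N ->
  (2 * theta i <= theta k)%N.
Hypothesis c_ge0 : forall i, 0 <= c i.
Hypothesis ab_le : forall n j i, a n j i ^+ 2 + b n j i ^+ 2 <= c i ^+ 2.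
Hypothesis J_gt0 : forall n, (0 < J n)%N.

Let N r := Num.truncn (X r).

Definition sqsum n r := \sum_(i < n) (r ^+ i * c i) ^+ 2.
Hypothesis sqsum_gt0 : forall r, D r -> 0 < sqsum (N r) r.

(** Chernoff parameters: [lam] satisfies lam^2 * sqsum = lg, so every exp(lam * trig_sum) has mean
    at most exp(2 lg), and exp(- lg) = 1 / (J h) pays for a union over J sums and for the weight
    h. *)
Let lg n r := ln ((J n)%:R * h r).
Let lam n r := Num.sqrt (lg n r) * sqsum n r `^ (- 2^-1).
Definition trig_sum n j r t := \sum_(i < n | P n j i)
  r ^+ i * (a n j i * cos ((theta i)%:R * t) + b n j i * sin ((theta i)%:R * t)).
(** A smooth substitute for the indicator of the bad event: it exceeds 1 as soon as some lam *
    trig_sum exceeds 3 lg. *)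
Let psi n r t := expR (- (3 * lg n r)) *
  \sum_(j < J n) expR (lam n r * trig_sum n j r t).

Let lg_gt0 r : D r -> 0 < lg (N r) r.
Proof.
move=> Dr; apply: ln_gt0; apply: (lt_le_trans (h_gt1 Dr)).
by rewrite ler_peMl ?ler1n//; exact: ltW (lt_trans ltr01 (h_gt1 Dr)).
Qed.

Let lam_gt0 r : D r -> 0 < lam (N r) r.
Proof.
by move=> Dr; rewrite mulr_gt0 ?sqrtr_gt0 ?lg_gt0// powR_gt0// sqsum_gt0.
Qed.

Let lam2 r : D r -> lam (N r) r ^+ 2 * sqsum (N r) r = lg (N r) r.
Proof.
move=> Dr; rewrite exprMn sqr_sqrtr ?(ltW (lg_gt0 _))// powRN powR12_sqrt.
  by rewrite exprVn sqr_sqrtr ?mulfVK ?gt_eqF ?ltW ?sqsum_gt0.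
by rewrite ltW// sqsum_gt0.
Qed.

Let mpsi n : measurable_fun setT (fun z : R * R => psi n z.1 z.2).
Proof.
have mlg : measurable_fun setT (lg n).
  apply: (measurableT_comp (@measurable_ln R)).
  by apply: measurable_funM => //; exact: measurable_cst.
have mlam : measurable_fun setT (lam n).
  apply: measurable_funM.
    apply: (measurableT_comp _ mlg).
    exact: (continuous_measurable_fun (@sqrt_continuous R)).
  apply: (measurableT_comp (measurable_powR _)).
  apply: measurable_fun_bigsum => i; apply: measurable_funX.
  by apply: measurable_funM; [exact: exprn_measurable|exact: measurable_cst].
have mtrig (f : R -> R) (k : R) : continuous f -> measurable_fun setT (fun z : R * R => f (k * z.2)).
  move=> cf; apply: (measurableT_comp (continuous_measurable_fun cf)).
  by apply: measurable_funM; [exact: measurable_cst|exact: measurable_snd].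
apply: measurable_funM.
  apply: (measurableT_comp (@measurable_expR R)); apply: measurableT_comp => //.
  apply: measurable_funM; first exact: measurable_cst.
  exact: (measurableT_comp mlg measurable_fst).
apply: measurable_fun_bigsum => j.
apply: (measurableT_comp (@measurable_expR R)); apply: measurable_funM.
  exact: (measurableT_comp mlam measurable_fst).
apply: measurable_fun_bigsum => i; apply: measurable_funM.
  by apply: measurable_funX; exact: measurable_fst.
apply: measurable_funD; apply: measurable_funM;
  by [exact: measurable_cst|apply: mtrig; [exact: continuous_cos||exact: continuous_sin]].
Qed.
Let psi_ge0 n r t : 0 <= psi n r t.
Proof.
by rewrite mulr_ge0 ?expR_ge0// sumr_ge0// => i _; exact: expR_ge0.
Qed.

(** The absolute value makes [F] nonnegative on the whole plane; over D it is h * psi. *)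
Let F (z : R * R) := `|h z.1| * psi (N z.1) z.1 z.2.

Let mF : measurable_fun setT F.
Proof.
(* The number of summands varies with r; on each of these countably many strips it is fixed, and
   [mpsi] applies. *)
pose S n := [set z : R * R | N z.1 = n].
have mS n : measurable (S n).
  exact: (measurable_truncn_preimage n (measurableT_comp mX measurable_fst)).
have -> : setT = \bigcup_n S n by apply/seteqP; split => z // _; exists (N z.1).
apply/(measurable_fun_bigcup _ mS) => n.
apply: (@eq_measurable_fun _ _ _ _ _ (fun z : R * R => `|h z.1| * psi n z.1 z.2)).
  by move=> z /set_mem; rewrite /S/= => Nz; rewrite /F Nz.
apply: measurable_funTS; apply: measurable_funM; last exact: mpsi.
by apply: measurableT_comp => //; exact: (measurableT_comp mh measurable_fst).
Qed.

(** Each of the J exponentials has mean at most exp(2 lg), and h * J * exp(2 lg - 3 lg) = 1. The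
    resulting bound does not depend on r, as Tonelli's argument requires. *)
Let integral_F_le l r : (0 < l)%N -> D r ->
  (\int[lebesgue_measure]_(t in `[(- (l%:R * pi))%R, (l%:R * pi)%R]) (F (r, t))%:E
   <= (2 * (l%:R * pi))%:E)%E.
Proof.
move=> l0 Dr; set n := N r; set p := l%:R * pi.
have h0 : 0 < h r := lt_trans ltr01 (h_gt1 Dr).
have p0 : 0 < p by rewrite mulr_gt0 ?ltr0n ?pi_gt0.
pose g := lg n r; pose k : R := h r * expR (- (3 * g)).
have k0 : 0 <= k by rewrite mulr_ge0 ?expR_ge0 ?ltW.
pose Y (j : 'I_(J n)) t : R := expR (lam n r * trig_sum n j r t).
have rho0 i : 0 <= lam n r * (r ^+ i * c i).
  move: (D01 Dr); rewrite /= in_itv/= => /andP[r0 _].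
  apply: mulr_ge0; first exact: ltW (lam_gt0 Dr).
  by apply: mulr_ge0 => //; apply: exprn_ge0; exact: ltW.
have YE j t : Y j t = expR (\sum_(i < n | P n j i)
    ((lam n r * r ^+ i * a n j i) * cos ((theta i)%:R * t)
     + (lam n r * r ^+ i * b n j i) * sin ((theta i)%:R * t))).
  rewrite /Y /trig_sum mulr_sumr; congr expR; apply: eq_bigr => i _; ring.
have IY (j : 'I_(J n)) : (\int[lebesgue_measure]_(t in `[(- p)%R, p]) (Y j t)%:E
    <= (2 * p * expR (2 * g))%:E)%E.
  under eq_integral do rewrite YE.
  have ab' i : (lam n r * r ^+ i * a n j i) ^+ 2 + (lam n r * r ^+ i * b n j i) ^+ 2
      <= (lam n r * (r ^+ i * c i)) ^+ 2.
    rewrite mulrA; set w := lam n r * r ^+ i.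
    rewrite (_ : _ + _ = w ^+ 2 * (a n j i ^+ 2 + b n j i ^+ 2)); last by ring.
    by rewrite [leRHS]exprMn; apply: ler_wpM2l => //; exact: sqr_ge0.
  apply: (le_trans (integral_exp_trig_le l0 theta_gt0 (@theta2 n j) rho0 ab' n)).
  rewrite lee_fin (_ : \sum_(i < n) _ = g)//.
  rewrite /g -lam2// /sqsum mulr_sumr; apply: eq_bigr => i _.
  by rewrite exprMn.
have mY j : measurable_fun setT (Y j).
  have := @continuous_sum R 'I_n (index_enum _) (P n j) (fun i t =>
    ((lam n r * r ^+ i * a n j i) * cos ((theta i)%:R * t)
     + (lam n r * r ^+ i * b n j i) * sin ((theta i)%:R * t)))
    (fun i => @continuous_trig _ _ _ _).
  move=> /continuous_measurable_fun mS.
  apply: (eq_measurable_fun _ _ (measurableT_comp (@measurable_expR R) mS)).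
  by move=> t _; rewrite YE.
have FE t : (F (r, t))%:E = (k%:E * \sum_(j < J n) (Y j t)%:E)%E.
  by rewrite sumEFin -EFinM /F/= gtr0_norm// /k mulrA.
under eq_integral do rewrite FE.
have mYE (j : 'I_(J n)) : measurable_fun (`[- p, p]%classic : set R) (EFin \o Y j).
  by apply/measurable_EFinP; exact: measurable_funTS.
have mpp : measurable (`[- p, p]%classic : set R) by exact: measurable_itv.
rewrite ge0_integralZl_EFin//; last 2 first.
- by move=> t _; apply: sume_ge0 => j _; rewrite lee_fin expR_ge0.
- by apply: emeasurable_sum => j; exact: mYE.
rewrite ge0_integral_sum//; last by move=> j t _; rewrite lee_fin expR_ge0.
have kJ : k * ((J n)%:R * (2 * p * expR (2 * g))) = 2 * p.
  have hJ : expR g = (J n)%:R * h r.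
    by rewrite /g /lg lnK// posrE mulr_gt0// ltr0n.
  have -> : k * ((J n)%:R * (2 * p * expR (2 * g)))
     = 2 * p * (((J n)%:R * h r) * (expR (- (3 * g)) * expR (2 * g))).
    by rewrite /k; ring.
  rewrite -hJ -!expRD (_ : g + _ = 0); last by ring.
  by rewrite expR0 mulr1.
rewrite -/p -kJ [leRHS]EFinM; apply: lee_wpmul2l; first by rewrite lee_fin.
apply: (le_trans (lee_sum _ (fun j _ => IY j))).
by rewrite sumEFin sumr_const card_ord (mulr_natl _ (J n)).
Qed.

(** Markov's inequality in r for fixed t: where psi > 1 one has h < h * psi = F, and F is integrable
    in r for almost every t. Off that set psi <= 1 controls every sum at once. *)
Lemma trig_sum_ae_bound :
  {ae lebesgue_measure, forall t : R, exists E : set R,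
    [/\ E `<=` D, finite_integral_on h E &
    forall r, D r -> ~ E r -> forall j, (j < J (N r))%N ->
      trig_sum (N r) j r t <=
      3 * Num.sqrt (lg (N r) r) * Num.sqrt (sqsum (N r) r)]}.
Proof.
have aeT (l : nat) : {ae lebesgue_measure, forall t : R,
    `[- (l.+1%:R * pi), l.+1%:R * pi]%classic t ->
    (\int[lebesgue_measure]_(r in D) (F (r, t))%:E < +oo)%E}.
  apply: (tonelli_ae_lt_pinfty mD D01 _ mF).
  - exact: measurable_itv.
  - by move=> z; rewrite mulr_ge0.
  - by move=> r Dr; exact: integral_F_le.
have /ae_foralln := aeT; apply: filterS => t Ht.
have Fin : (\int[lebesgue_measure]_(r in D) (F (r, t))%:E < +oo)%E.
  (* The intervals indexed by l cover the line, since |t| < l + 1 <= (l + 1) pi for l the integer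
     part of |t|. *)
  apply: (Ht (Num.truncn `|t|)); rewrite /= in_itv/= -ler_norml.
  apply: (le_trans (ltW (truncnS_gt _))).
  by rewrite ler_peMr// (le_trans _ (pi_ge2 R))// ler1n.
pose E := D `&` [set r | 1 < psi (N r) r t].
have mFt : measurable_fun setT (fun r => F (r, t)).
  exact: (measurableT_comp mF (measurable_pair2 t)).
have hD r : D r -> 0 < h r by move=> /h_gt1; exact: lt_trans.
have FE r : D r -> F (r, t) = h r * psi (N r) r t.
  by move=> Dr; rewrite /F/= gtr0_norm ?hD.
have EE : E = D `&` [set r | h r < F (r, t)].
  apply/seteqP; split => r [Dr] /= p1; split => //=.
    by rewrite FE// ltr_pMr ?hD.
  by move: p1; rewrite FE// ltr_pMr ?hD.
have mE : measurable E.
  rewrite EE; exact: (measurable_fun_ltr (measurable_funTS mh) (measurable_funTS mFt) mD (Y := [set true]) I).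
exists E; split; [by move=> r []|split => //|].
- by move=> r [/D01].
- apply: le_lt_trans Fin.
  apply: (@le_trans _ _ (\int[lebesgue_measure]_(r in E) (F (r, t))%:E)%E).
    apply: ge0_le_integral => //=.
    + by move=> r [/hD /ltW]; rewrite lee_fin.
    + by apply/measurable_EFinP; exact: measurable_funTS.
    + by apply/measurable_EFinP; exact: measurable_funTS.
    + by move=> r; rewrite EE => -[_ /ltW]; rewrite lee_fin.
  apply: ge0_subset_integral => //=.
  + by apply/measurable_EFinP; exact: measurable_funTS.
  + by move=> r _; rewrite lee_fin mulr_ge0.
  + by move=> r [].
move=> r Dr Er j jJ; set n := N r.
have psi1 : psi n r t <= 1.
  by rewrite leNgt; apply/negP => p1; apply: Er.
(* A single summand of psi is at most psi; taking logarithms gives lam * trig_sum <= 3 lg, then one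
   divides by lam. *)
have : expR (lam n r * trig_sum n j r t - 3 * lg n r) <= 1.
  apply: le_trans psi1; rewrite addrC expRD ler_wpM2l ?expR_ge0//.
  rewrite (bigD1 (Ordinal jJ))//= lerDl sumr_ge0// => i _; exact: expR_ge0.
rewrite expR_le1 subr_le0 => le3.
have L0 := lg_gt0 Dr; have s0 := sqsum_gt0 Dr.
have l0 : 0 < lam n r := lam_gt0 Dr.
rewrite -(ler_pM2l l0); apply: (le_trans le3).
rewrite [leRHS](_ : _ = 3 * (Num.sqrt (lg n r) ^+ 2) * (sqsum n r `^ (- 2^-1) * Num.sqrt (sqsum n r)));
  last by rewrite /lam /lg -/n; ring.
rewrite powRN powR12_sqrt ?(ltW s0)// mulVf ?mulr1 ?sqr_sqrtr ?(ltW L0)//.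
by rewrite gt_eqF// sqrtr_gt0.
Qed.

End random_bound.

(** * Power series with nonnegative coefficients *)

Definition summable_on_disc (R : realType) (c : nat -> R) :=
  (forall n, 0 <= c n) /\ forall x, 0 < x < 1 -> cvgn (pseries c x).

Definition psum (R : realType) (c : nat -> R) (x : R) := limn (pseries c x).

(** Coefficients of x g'(x) when c are those of g. *)
Definition euler_op (R : realType) (c : nat -> R) (n : nat) := n%:R * c n.

Section power_series_theory.
Variable R : realType.
Implicit Types (c : nat -> R) (x r : R).

Lemma bernoulli_le (d : R) n : 0 <= d -> 1 + n%:R * d <= (1 + d) ^+ n.
Proof.
move=> d0; elim: n => [|n IH]; first by rewrite mul0r addr0 expr0.
rewrite exprS; apply: (@le_trans _ _ ((1 + d) * (1 + n%:R * d))).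
  have : 0 <= n%:R * d * d by rewrite !mulr_ge0.
  rewrite -natr1; lra.
by rewrite ler_wpM2l// addr_ge0.
Qed.

(** Compare with the series at y, the midpoint of x and 1: writing y = x (1 + d), Bernoulli's
    inequality gives n x^n <= y^n / d. *)
Lemma summable_euler_op c : summable_on_disc c -> summable_on_disc (euler_op c).
Proof.
move=> [c0 cc]; split => [n|x /andP[x0 x1]]; first by rewrite mulr_ge0.
pose y := (1 + x) / 2; pose d := y / x - 1.
have y01 : 0 < y < 1 by rewrite /y; lra.
have d0 : 0 < d by rewrite /d subr_gt0 ltr_pdivlMr// /y; lra.
have xn n : n%:R * x ^+ n <= d^-1 * y ^+ n.
  have -> : y = x * (1 + d) by rewrite /d; field; rewrite gt_eqF.
  have nd : n%:R <= d^-1 * (1 + d) ^+ n.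
    rewrite ler_pdivlMl// mulrC; apply: le_trans (bernoulli_le n (ltW d0)).
    by rewrite lerDr.
  rewrite exprMn mulrCA mulrC; apply: ler_wpM2l => //.
  by rewrite exprn_ge0// ltW.
apply: (@series_le_cvg _ _ (fun n => d^-1 * (c n * y ^+ n))).
- by move=> n; rewrite !mulr_ge0// exprn_ge0// ltW.
- by move=> n; rewrite !mulr_ge0// ?exprn_ge0 ?invr_ge0 ?ltW//; case/andP: y01.
- move=> n; rewrite /euler_op /= [leLHS](_ : _ = c n * (n%:R * x ^+ n)); last by ring.
  by rewrite [leRHS]mulrCA; apply: ler_wpM2l.
- by apply: is_cvg_seriesZ; exact: cc.
Qed.

Lemma pseries_diffsE c x N : x != 0 ->
  pseries (pseries_diffs c) x N = x^-1 * pseries (euler_op c) x N.+1.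
Proof.
move=> x0; rewrite /pseries /series/= big_nat_recl//= /euler_op mul0r mul0r add0r.
rewrite mulr_sumr; apply: eq_bigr => i _; rewrite /pseries_diffs exprS.
by field.
Qed.

Lemma cvg_pseries_diffs c x : summable_on_disc c -> 0 < x < 1 ->
  pseries (pseries_diffs c) x @ \oo --> psum (euler_op c) x / x.
Proof.
move=> sc x01; have [_ /(_ _ x01) cc] := summable_euler_op sc.
have x0 : x != 0 by rewrite gt_eqF//; case/andP: x01.
have -> : pseries (pseries_diffs c) x =
    (fun N => x^-1 * pseries (euler_op c) x N.+1).
  by apply/funext => N; exact: pseries_diffsE.
rewrite mulrC; apply: cvgM; first exact: cvg_cst.
by rewrite (cvg_shiftS (pseries (euler_op c) x)).
Qed.

Lemma summable_pseries_diffs c : summable_on_disc c ->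
  summable_on_disc (pseries_diffs c).
Proof.
move=> sc; split => [n|x x01]; first by rewrite mulr_ge0//; exact: sc.1.
by apply/cvg_ex; eexists; exact: cvg_pseries_diffs.
Qed.

Lemma is_derive_psum c r : summable_on_disc c -> 0 < r < 1 ->
  is_derive r (1 : R) (psum c) (psum (euler_op c) r / r).
Proof.
move=> sc r01; rewrite -(cvg_lim _ (cvg_pseries_diffs sc r01))//.
(* Termwise differentiation at r needs the series and its two formal derivatives to converge at a
   point beyond r. *)
have K01 : 0 < (1 + r) / 2 < 1 by lra.
have sd := summable_pseries_diffs sc.
apply: (@pseries_snd_diffs _ c ((1 + r) / 2)).
- exact: sc.2.
- exact: sd.2.
- exact: (summable_pseries_diffs sd).2.
- by rewrite !gtr0_norm; lra.
Qed.

Lemma continuous_psum c r : summable_on_disc c -> 0 < r < 1 ->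
  {for r, continuous (psum c)}.
Proof.
move=> sc r01; apply: differentiable_continuous; apply/derivable1_diffP.
have d := is_derive_psum sc r01; exact: ex_derive.
Qed.

Lemma pseries_le_psum c r N : summable_on_disc c -> 0 < r < 1 ->
  pseries c r N <= psum c r.
Proof.
move=> [c0 cc] r01; apply: nondecreasing_cvgn_le; last exact: cc.
apply/nondecreasing_seqP => n; rewrite /pseries /series/= big_nat_recr//= lerDl.
by rewrite mulr_ge0// exprn_ge0// ltW//; case/andP: r01.
Qed.

Lemma psum_ge0 c r : summable_on_disc c -> 0 < r < 1 -> 0 <= psum c r.
Proof.
move=> sc r01; apply: le_trans (pseries_le_psum 0 sc r01).
by rewrite /pseries /series/= big_geq.
Qed.

Lemma psum_le c r B : summable_on_disc c -> 0 < r < 1 ->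
  (forall N, pseries c r N <= B) -> psum c r <= B.
Proof.
by move=> [_ cc] r01 cB; apply: limr_le; [exact: cc|exact: nearW].
Qed.

Lemma psum_term_le c r n : summable_on_disc c -> 0 < r < 1 ->
  c n * r ^+ n <= psum c r.
Proof.
move=> sc r01; apply: le_trans (pseries_le_psum n.+1 sc r01).
rewrite /pseries /series/= big_nat_recr//= lerDr sumr_ge0// => i _.
by rewrite mulr_ge0 ?sc.1// exprn_ge0// ltW//; case/andP: r01.
Qed.

(* Mean and variance of the probability on nat with weights c_n r^n. *)
Definition pmean c r := psum (euler_op c) r / psum c r.
Definition pvar c r :=
  psum (euler_op (euler_op c)) r / psum c r - pmean c r ^+ 2.

Lemma pmean_ge0 c r : summable_on_disc c -> 0 < r < 1 -> 0 <= pmean c r.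
Proof.
move=> sc r01; rewrite divr_ge0 ?psum_ge0//; exact: summable_euler_op.
Qed.

(** Expanding the square expresses the left side by partial sums of three convergent series; it is
    nondecreasing in N and its limit is the right side. *)
Lemma sum_sqdev_le c r N : summable_on_disc c -> 0 < r < 1 -> 0 < psum c r ->
  \sum_(0 <= i < N) (i%:R - pmean c r) ^+ 2 * (c i * r ^+ i)
    <= pvar c r * psum c r.
Proof.
move=> sc r01 g0; set A := pmean c r; set g := psum c r.
have sc1 := summable_euler_op sc; have sc2 := summable_euler_op sc1.
pose u n := pseries (euler_op (euler_op c)) r n
   - 2 * A * pseries (euler_op c) r n + A ^+ 2 * pseries c r n.
have uE n : \sum_(0 <= i < n) (i%:R - A) ^+ 2 * (c i * r ^+ i) = u n.
  rewrite /u /pseries /series/= !mulr_sumr -sumrB -big_split/=.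
  by apply: eq_bigr => i _; rewrite /euler_op; ring.
have cu : u @ \oo --> psum (euler_op (euler_op c)) r
   - 2 * A * psum (euler_op c) r + A ^+ 2 * g.
  apply: cvgD; first apply: cvgB; last 2 first.
  - by apply: cvgM; [exact: cvg_cst|exact: sc1.2].
  - by apply: cvgM; [exact: cvg_cst|exact: sc.2].
  - exact: sc2.2.
have -> : pvar c r * g = psum (euler_op (euler_op c)) r
   - 2 * A * psum (euler_op c) r + A ^+ 2 * g.
  by rewrite /pvar /A /pmean -/g; field; rewrite gt_eqF.
rewrite uE -(cvg_lim _ cu)//; apply: nondecreasing_cvgn_le.
  apply/nondecreasing_seqP => n; rewrite -!uE big_nat_recr//= lerDl.
  by rewrite mulr_ge0 ?sqr_ge0// mulr_ge0 ?sc.1// exprn_ge0// ltW//; case/andP: r01.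
by apply/cvg_ex; eexists; exact: cu.
Qed.

Lemma pvar_ge0 c r : summable_on_disc c -> 0 < r < 1 -> 0 < psum c r ->
  0 <= pvar c r.
Proof.
move=> sc r01 g0; have := sum_sqdev_le 0 sc r01 g0.
by rewrite big_geq// pmulr_lge0.
Qed.

Lemma sum_itv_nat m M N :
  (\sum_(0 <= i < N) (m <= i <= M : nat) <= M.+1 - m)%N.
Proof.
suff -> : (\sum_(0 <= i < N) (m <= i <= M : nat) = minn N M.+1 - m)%N.
  by rewrite leq_sub2r// geq_minr.
elim: N => [|N IH]; first by rewrite big_geq// min0n.
rewrite big_nat_recr//= IH; case: (leqP m N) => h1; case: (leqP N M) => h2 /=;
  rewrite ?addn0 ?addn1; lia.
Qed.

(* Chebyshev: half of the mass sits within sqrt(2V+2) of the mean. *)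
Lemma psum_le_max_term c r mu : summable_on_disc c -> 0 < r < 1 ->
  0 < psum c r -> (forall n, c n * r ^+ n <= mu) ->
  psum c r <= 4 * mu * (Num.sqrt (2 * pvar c r + 2) + 1).
Proof.
move=> sc r01 g0 cmu; have V0 := pvar_ge0 sc r01 g0.
set V := pvar c r in V0 *; set A := pmean c r; set s := Num.sqrt (2 * V + 2).
(* With this s the mass outside the window is at most V g / (2V + 2) <= g / 2; the summand 2 keeps s
   positive when V = 0. *)
have s2 : s ^+ 2 = 2 * V + 2 by rewrite sqr_sqrtr//; lra.
have s0 : 0 < s by rewrite sqrtr_gt0; lra.
have A0 : 0 <= A by exact: pmean_ge0.
have r0 : 0 <= r by rewrite ltW//; case/andP: r01.
have cr0 i : 0 <= c i * r ^+ i by rewrite mulr_ge0 ?sc.1// exprn_ge0.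
have mu0 : 0 <= mu by exact: le_trans (cr0 0%N) (cmu 0%N).
pose m := Num.truncn (A - s); pose M := Num.truncn (A + s).
(* The number of integers in the window; truncation of a negative A - s to 0 respects the bound. *)
have mM : (M.+1 - m)%N%:R <= 2 * s + 2.
  have hM : M%:R <= A + s by rewrite truncn_le addr_ge0// ltW.
  have hm : A - s < m.+1%:R by exact: truncnS_gt.
  have [le|lt] := leqP m M.+1.
    by rewrite natrB// -natr1; rewrite -natr1 in hm; lra.
  by rewrite (eqP (ltnW lt : (M.+1 - m)%N == 0%N)); lra.
suff H N : pseries c r N <= mu * (2 * s + 2) + psum c r / 2.
  have := psum_le sc r01 H; lra.
(* Inside the window a term is at most mu; outside it the Chebyshev weight (i - A)^2 / s^2 is at
   least 1. *)
have step i : c i * r ^+ i <=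
    mu * (m <= i <= M)%N%:R + s ^- 2 * ((i%:R - A) ^+ 2 * (c i * r ^+ i)).
  have [/andP[mi iM]|/nandP out] := boolP (m <= i <= M)%N.
    rewrite mulr1 (le_trans (cmu i))// lerDl.
    by rewrite mulr_ge0 ?invr_ge0 ?sqr_ge0// mulr_ge0// sqr_ge0.
  rewrite mulr0 add0r mulrA ler_peMl//.
  rewrite mulrC ler_pdivlMr ?exprn_gt0// mul1r.
  case: out; rewrite -ltnNge => out.
    have h : i.+1%:R <= A - s by rewrite -truncn_gt_nat.
    rewrite -natr1 in h; have i0 : 0 <= i%:R :> R by []; nra.
  have h : A + s < i%:R.
    apply: lt_le_trans (truncnS_gt _) _; rewrite ler_nat; exact: out.
  nra.
apply: (@le_trans _ _ (\sum_(0 <= i < N) (mu * (m <= i <= M)%N%:R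
    + s ^- 2 * ((i%:R - A) ^+ 2 * (c i * r ^+ i))))).
  by apply: ler_sum => i _; exact: step.
rewrite big_split/= -!mulr_sumr; apply: lerD.
  rewrite ler_wpM2l// -natr_sum (le_trans _ mM)// ler_nat; exact: sum_itv_nat.
rewrite mulrC ler_pdivrMr ?exprn_gt0// (le_trans (sum_sqdev_le N sc r01 g0))//.
rewrite s2 -/V; nra.
Qed.

(** Markov's inequality: the index is at least n on the tail. *)
Lemma pseries_tail_le c r n M : summable_on_disc c -> 0 < r < 1 -> (0 < n)%N ->
  \sum_(n <= i < M) c i * r ^+ i <= psum (euler_op c) r / n%:R.
Proof.
move=> sc r01 n0; rewrite ler_pdivlMr ?ltr0n// mulr_suml.
have r0 : 0 <= r by rewrite ltW//; case/andP: r01.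
have cr0 i : 0 <= c i * r ^+ i by rewrite mulr_ge0 ?sc.1// exprn_ge0.
have [Mn|nM] := leqP M n.
  by rewrite big_geq// psum_ge0//; exact: summable_euler_op.
apply: le_trans (pseries_le_psum M (summable_euler_op sc) r01).
rewrite /pseries /series/= [leRHS](big_cat_nat _ (n := n))//=; last exact: ltnW.
apply: (@le_trans _ _ (\sum_(n <= i < M) euler_op c i * r ^+ i)).
  rewrite [leLHS]big_nat [leRHS]big_nat; apply: ler_sum => i /andP[ni _].
  rewrite mulrC /euler_op -mulrA; apply: ler_wpM2r => //; by rewrite ler_nat.
rewrite lerDr sumr_ge0// => i _; rewrite /euler_op -mulrA mulr_ge0//.
Qed.

End power_series_theory.

(** * Wiman-Valiron estimates off a small set *)

Section log_derivative.
Variables (R : realType) (h : R -> R).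
Hypothesis mh : measurable_fun (`]0, 1[ : set R) h.
Hypothesis h_gt0 : forall r, 0 < r < 1 -> 0 < h r.

(** Borel-Nevanlinna applied to u = - (ln w)^(- eps) / eps, which is bounded because w >= e and has
    derivative w' / (w (ln w)^(1 + eps)). *)
Lemma log_derivative_le_except (w w' : R -> R) (s eps : R) : 0 < eps ->
  0 <= s -> s < 1 ->
  (forall r, s < r < 1 -> is_derive r (1 : R) w (w' r)) ->
  (forall r, s < r < 1 -> {for r, continuous w'}) ->
  (forall r, s < r < 1 -> 0 <= w' r) ->
  (forall r, s < r < 1 -> expR 1 <= w r) ->
  finite_integral_on h
    [set r | s < r < 1 /\ h r * (w r * ln (w r) `^ (1 + eps)) < w' r].
Proof.
move=> e0 s0 s1 dw cw' w'0 we.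
have w0 r : s < r < 1 -> 0 < w r.
  by move=> /we; apply: lt_le_trans; exact: expR_gt0.
have lw1 r : s < r < 1 -> 1 <= ln (w r).
  by move=> sr; rewrite -[leLHS]expRK ler_ln ?posrE ?expR_gt0 ?w0 ?we.
have lw0 r : s < r < 1 -> 0 < ln (w r).
  by move=> /lw1; apply: lt_le_trans.
pose u r := - eps^-1 * ln (w r) `^ (- eps).
pose u' r := ln (w r) `^ (- eps - 1) * ((w r)^-1 * w' r).
have du r : s < r < 1 -> is_derive r (1 : R) u (u' r).
  move=> sr; have d1 := dw _ sr.
  have d2 := is_derive1_ln (w0 _ sr).
  have d3 := is_derive1_powR (- eps) (lw0 _ sr).
  have d4 := is_derive1_comp d2 d1.
  have d5 := is_derive1_comp (g := @ln R \o w) d3 d4.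
  have d6 := @is_deriveZ _ _ _ _ (- eps^-1) _ _ _ d5.
  apply: is_derive_eq d6 _.
  rewrite /u' /GRing.scale/=; field; by rewrite !gt_eqF ?w0.
have cw r : s < r < 1 -> {for r, continuous w}.
  move=> sr; apply: differentiable_continuous; apply/derivable1_diffP.
  have d := dw _ sr; exact: ex_derive.
have clw r : s < r < 1 -> {for r, continuous (fun r => ln (w r))}.
  move=> sr; apply: (@cvg_comp _ _ _ w (@ln R) _ (nbhs (w r))); first exact: cw.
  by apply: continuous_ln; exact: w0.
have cu' r : s < r < 1 -> {for r, continuous u'}.
  move=> sr; apply: cvgM.
    apply: (@cvg_comp _ _ _ (fun r => ln (w r)) (fun x => x `^ (- eps - 1)) _
      (nbhs (ln (w r)))); first exact: clw.
    have cp : {for ln (w r), continuous (fun x : R => x `^ (- eps - 1))}.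
      apply: differentiable_continuous; apply/derivable1_diffP.
      have d := is_derive1_powR (- eps - 1) (lw0 _ sr); exact: ex_derive.
    exact: cp.
  apply: cvgM; last exact: cw'.
  by apply: cvgV; [rewrite gt_eqF// w0|exact: cw].
have uM r : s < r < 1 -> `|u r| <= eps^-1.
  move=> sr; rewrite /u normrM normrN (ger0_norm (powR_ge0 _ _)) gtr0_norm ?invr_gt0//.
  rewrite ger_pMr ?invr_gt0// powRN invf_le1 ?powR_gt0 ?lw0//.
  rewrite -(powRr0 (ln (w r))); apply: ler_powR; [exact: lw1|exact: ltW].
have u'0 r : s < r < 1 -> 0 <= u' r.
  by move=> sr; rewrite !mulr_ge0 ?powR_ge0 ?w'0// invr_ge0 ltW// w0.
have := derivative_le_except mh h_gt0 s0 s1 du cu' u'0 uM.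
congr (finite_integral_on h _); apply/seteqP.
suff E r : s < r < 1 -> (h r < u' r) = (h r * (w r * ln (w r) `^ (1 + eps)) < w' r).
  by split => r [sr]; [rewrite E|rewrite -E].
move=> sr.
have p0 : 0 < w r * ln (w r) `^ (1 + eps) by rewrite mulr_gt0 ?powR_gt0 ?w0 ?lw0.
rewrite -[RHS](ltr_pdivlMr _ _ p0); congr (_ < _).
rewrite /u' (_ : - eps - 1 = - (1 + eps)); last by ring.
rewrite powRN; field.
by rewrite !gt_eqF ?w0 ?powR_gt0 ?lw0.
Qed.

Section wiman_valiron.
Variables (c : nat -> R) (eps : R).
Hypothesis sc : summable_on_disc c.
Hypothesis eps_gt0 : 0 < eps.
Hypothesis g_gt0 : forall r, 0 < r < 1 -> 0 < psum c r.

Let sc1 := summable_euler_op sc.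
Let sc2 := summable_euler_op sc1.
Let s : R := 2^-1.
Let sub (r : R) : s < r < 1 -> 0 < r < 1.
Proof. by rewrite /s; lra. Qed.

(* The constant makes log_psum at least e on (1/2, 1). *)
Definition log_psum r := ln (psum c r) + (expR 1 - ln (psum c 2^-1)).

Lemma continuous_pmean (r : R) : 0 < r < 1 -> {for r, continuous (pmean c)}.
Proof.
move=> r01; apply: cvgM; first exact: continuous_psum.
by apply: cvgV; [rewrite gt_eqF ?g_gt0|exact: continuous_psum].
Qed.

Lemma continuous_pvar (r : R) : 0 < r < 1 -> {for r, continuous (pvar c)}.
Proof.
move=> r01; apply: cvgB; last by apply: cvgM; exact: continuous_pmean.
apply: cvgM; first exact: continuous_psum.
by apply: cvgV; [rewrite gt_eqF ?g_gt0|exact: continuous_psum].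
Qed.

(** The weights form an exponential family in the parameter ln r: r d/dr sends ln g to the mean and
    the mean to the variance. *)
Let is_derive_log (r : R) : 0 < r < 1 -> is_derive r (1 : R) log_psum (pmean c r / r).
Proof.
move=> r01; have d1 := is_derive_psum sc r01.
have d2 := is_derive1_ln (g_gt0 r01).
have d3 := is_derive1_comp d2 d1.
have d4 := is_deriveD d3 (is_derive_cst (expR 1 - ln (psum c 2^-1)) r 1).
by apply: is_derive_eq d4 _; rewrite addr0 /pmean; ring.
Qed.

Let is_derive_pmean (r : R) : 0 < r < 1 ->
  is_derive r (1 : R) (fun r => pmean c r + expR 1) (pvar c r / r).
Proof.
move=> r01; have d1 := is_derive_psum sc r01.
have d2 := is_derive_psum sc1 r01.
have g0 := g_gt0 r01.
have g1 : psum c r != 0 by rewrite gt_eqF.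
have r1 : r != 0 by rewrite gt_eqF//; case/andP: r01.
have d3 := is_deriveV g1 d1.
have d4 := is_deriveM d2 d3.
have d5 := is_deriveD d4 (is_derive_cst (expR 1) r 1).
apply: is_derive_eq d5 _; rewrite addr0 /pvar /pmean /GRing.scale/=.
by field; rewrite g1 r1.
Qed.

Lemma log_psum_ge r : 2^-1 <= r -> r < 1 -> expR 1 <= log_psum r.
Proof.
move=> r2 r1; rewrite /log_psum; suff : ln (psum c 2^-1) <= ln (psum c r) by lra.
have h01 : 0 < (2^-1 : R) < 1 by lra.
have r01 : 0 < r < 1 by lra.
rewrite ler_ln ?posrE ?g_gt0//; apply: psum_le => // N.
apply: le_trans (pseries_le_psum N sc r01).
rewrite /pseries /series/=; apply: ler_sum => i _; apply: ler_wpM2l; first exact: sc.1.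
by rewrite lerXn2r// nnegrE; lra.
Qed.

(** [log_derivative_le_except] is used for w = log_psum and for w = A + e, where the shift ensures w
    >= e. The factors 1/r in the derivatives are dropped since r < 1. *)
Lemma mean_variance_except : exists2 E, finite_integral_on h E &
  forall r, 2^-1 < r < 1 -> ~ E r ->
    pmean c r <= h r * (log_psum r * ln (log_psum r) `^ (1 + eps)) /\
    pvar c r <= h r * ((pmean c r + expR 1) * ln (pmean c r + expR 1) `^ (1 + eps)).
Proof.
have s0 : 0 <= s by rewrite /s.
have s1 : s < 1 by rewrite /s; lra.
have cid (r : R) : s < r < 1 -> {for r, continuous (fun r : R => r^-1)}.
  move=> sr; apply: cvgV; last exact: cvg_id.
  by rewrite gt_eqF//; case/andP: (sub sr).
have f1 := @log_derivative_le_except log_psum (fun r => pmean c r / r) s eps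
  eps_gt0 s0 s1 _ _ _ _.
have f2 := @log_derivative_le_except (fun r => pmean c r + expR 1)
  (fun r => pvar c r / r) s eps eps_gt0 s0 s1 _ _ _ _.
eexists; first apply: (finite_integral_on_setU mh h_gt0); [apply: f1|apply: f2|].
- by move=> r /sub; exact: is_derive_log.
- by move=> r sr; apply: cvgM; [apply: continuous_pmean; exact: sub|exact: cid].
- move=> r /sub r01; rewrite divr_ge0 ?pmean_ge0//; lra.
- by move=> r /andP[sr r1]; rewrite log_psum_ge// ltW.
- by move=> r /sub; exact: is_derive_pmean.
- by move=> r sr; apply: cvgM; [apply: continuous_pvar; exact: sub|exact: cid].
- move=> r /sub r01; rewrite divr_ge0 ?pvar_ge0 ?g_gt0//; lra.
- by move=> r /sub r01; rewrite lerDr pmean_ge0.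
move=> r sr nE; have r01 := sub sr.
have le_div x : 0 <= x -> x <= x / r.
  by move=> x0; rewrite ler_pdivlMr ?ler_piMr//; lra.
split; rewrite leNgt; apply/negP => lt; apply: nE; [left|right]; split => //=;
  apply: (lt_le_trans lt); apply: le_div; [exact: pmean_ge0|].
exact: pvar_ge0 (g_gt0 r01).
Qed.

End wiman_valiron.
End log_derivative.

(** * Complex moduli and a net of the disc *)

Section modulus.
Variable R : realType.
Implicit Types (z w : C R) (u : nat -> C R).

Definition re z : R := complex.Re (z : R[i]).
Definition im z : R := complex.Im (z : R[i]).

Lemma reD z w : re (z + w) = re z + re w. Proof. by case: z; case: w. Qed.
Lemma reM z w : re (z * w) = re z * re w - im z * im w.
Proof. by case: z; case: w. Qed.
Lemma reB z w : re (z - w) = re z - re w. Proof. by case: z; case: w. Qed.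
Lemma imB z w : im (z - w) = im z - im w. Proof. by case: z; case: w. Qed.

Lemma re_sum I (s : seq I) (P : pred I) (F : I -> C R) :
  re (\sum_(i <- s | P i) F i) = \sum_(i <- s | P i) re (F i).
Proof. by apply: (big_morph re reD). Qed.

Lemma cmod_def z : cmod z = Num.sqrt (re z ^+ 2 + im z ^+ 2).
Proof. by case: z. Qed.

Lemma cmod_ge0 z : 0 <= cmod z. Proof. by rewrite cmod_def sqrtr_ge0. Qed.

Lemma sqr_cmod z : cmod z ^+ 2 = re z ^+ 2 + im z ^+ 2.
Proof. by rewrite cmod_def sqr_sqrtr// addr_ge0// sqr_ge0. Qed.

Lemma cmodM z w : cmod (z * w) = cmod z * cmod w.
Proof. exact: ComplexField.Normc.normcM. Qed.

Lemma cmodD z w : cmod (z + w) <= cmod z + cmod w.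
Proof. exact: le_normcD. Qed.

Lemma cmodN z : cmod (- z) = cmod z.
Proof. exact: normcN. Qed.

Lemma cmod0 : cmod (0 : C R) = 0.
Proof. exact: ComplexField.Normc.normc0. Qed.

Lemma cmod1 : cmod (1 : C R) = 1.
Proof. exact: ComplexField.Normc.normc1. Qed.

Lemma cmodB z w : cmod (z - w) <= cmod z + cmod w.
Proof. by rewrite -(cmodN w); exact: cmodD. Qed.

Lemma cmodX z n : cmod (z ^+ n) = cmod z ^+ n.
Proof. by elim: n => [|n IH]; rewrite ?cmod1// !exprS cmodM IH. Qed.

Lemma cmod_real (x : R) : cmod (x%:C%C : C R) = `|x|.
Proof. by rewrite cmod_def /re /im/= expr0n addr0 sqrtr_sqr. Qed.

Lemma cmod_eq0 z : cmod z = 0 -> z = 0.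
Proof. exact: ComplexField.Normc.eq0_normc. Qed.

Lemma cmod_sum I (s : seq I) (P : pred I) (F : I -> C R) :
  cmod (\sum_(i <- s | P i) F i) <= \sum_(i <- s | P i) cmod (F i).
Proof.
elim/big_rec2: _ => [|i x y _ yx]; first by rewrite cmod0.
by apply: le_trans (cmodD _ _) _; rewrite lerD2l.
Qed.

Lemma cmod_expi (s : R) : cmod (expi s) = 1.
Proof. by rewrite cmod_def /re /im /= cos2Dsin2 sqrtr1. Qed.

Lemma cmod_le_re_im z : cmod z <= `|re z| + `|im z|.
Proof.
rewrite -(ler_pXn2r (n := 2)) ?nnegrE ?cmod_ge0 ?addr_ge0// sqr_cmod.
rewrite -(real_normK (num_real (re z))) -(real_normK (num_real (im z))).
have : 0 <= `|re z| * `|im z| by rewrite mulr_ge0.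
nra.
Qed.

Lemma re_im_le z : `|re z| <= cmod z /\ `|im z| <= cmod z.
Proof.
by split; rewrite -(ler_pXn2r (n := 2)) ?nnegrE ?cmod_ge0// sqr_cmod
  real_normK ?num_real// ?lerDl ?lerDr sqr_ge0.
Qed.

Lemma cvg_cmod u z : u @ \oo --> z -> forall e : R, 0 < e ->
  exists N, forall n, (N <= n)%N -> cmod (z - u n) < e.
Proof.
move=> uz e e0.
have e0' : 0 < (e%:C%C : C R) by rewrite ltcR.
have /cvgrPdist_lt/(_ _ e0')[N _ HN] := uz.
by exists N => n Nn; have := HN n Nn; rewrite /= -ltcR.
Qed.

(* Convergence need not be assumed: a divergent limit is the default point 0. *)
Lemma cmod_limn_le u B N :
  (forall n, (N <= n)%N -> cmod (u n) <= B) -> cmod (limn u) <= B.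
Proof.
move=> uB; have B0 := le_trans (cmod_ge0 _) (uB N (leqnn N)).
have [cu|/dvgP ->] := pselect (cvgn u); last first.
  by rewrite [X in cmod X](_ : _ = 0 :> C R)// cmod0.
apply/ler_addgt0Pr => e e0; have [M HM] := cvg_cmod cu e0.
set n := maxn M N; have h1 := HM n (leq_maxl _ _); have h2 := uB n (leq_maxr _ _).
rewrite -[limn u](subrK (u n)); apply: le_trans (cmodD _ _) _.
by rewrite addrC lerD// ltW.
Qed.

(** Abel's argument: the terms at a point K between x and 1 are bounded, so the series at x is
    dominated by a geometric one of ratio x / K. *)
Lemma power_sum_summable (a : nat -> C R) f : is_power_sum_on_disc a f ->
  summable_on_disc (fun n => cmod (a n)).
Proof.
move=> af; split => [n|x x01]; first exact: cmod_ge0.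
pose K : R := (1 + x) / 2.
have K01 : 0 < K < 1 by rewrite /K; lra.
have xK : x < K by rewrite /K; lra.
have x0 : 0 <= x by lra.
have K0 : 0 <= K by lra.
have zK : cmod (K%:C%C : C R) < 1 by rewrite cmod_real ger0_norm//; lra.
have [N HN] := cvg_cmod (af _ zK) ltr01.
have tl n : (N <= n)%N -> cmod (a n) * K ^+ n <= 2.
  move=> Nn.
  have -> : cmod (a n) * K ^+ n = cmod (a n * (K%:C%C : C R) ^+ n).
    by rewrite cmodM cmodX cmod_real ger0_norm.
  have -> : a n * (K%:C%C : C R) ^+ n =
     (f K%:C%C - power_series a K%:C%C n) - (f K%:C%C - power_series a K%:C%C n.+1).
    rewrite /power_series /series/= big_nat_recr//=; ring.
  apply: le_trans (cmodB _ _) _.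
  by have := HN n Nn; have := HN n.+1 (leqW Nn); lra.
(* The sum covers the first N terms; later ones are differences of two partial sums within 1 of the
   limit, hence at most 2. *)
pose M := \sum_(i < N) cmod (a i) * K ^+ i + 2.
have aK0 i : 0 <= cmod (a i) * K ^+ i by rewrite mulr_ge0 ?cmod_ge0 ?exprn_ge0.
have aM n : cmod (a n) * K ^+ n <= M.
  have [Nn|nN] := leqP N n.
    by apply: le_trans (tl _ Nn) _; rewrite /M lerDr sumr_ge0.
  rewrite /M (bigD1 (Ordinal nN))//= -addrA lerDl addr_ge0// sumr_ge0//.
have M0 : 0 <= M := le_trans (aK0 0%N) (aM 0%N).
have Kn0 : K != 0 by rewrite gt_eqF; lra.
apply: (@series_le_cvg _ _ (fun n => M * (x / K) ^+ n)) => //=.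
- by move=> n; rewrite mulr_ge0 ?cmod_ge0 ?exprn_ge0.
- by move=> n; rewrite mulr_ge0// exprn_ge0// divr_ge0.
- move=> n; apply: (@le_trans _ _ (cmod (a n) * K ^+ n * (x / K) ^+ n)).
    rewrite -mulrA -exprMn mulrCA mulfV// mulr1//.
  by rewrite ler_wpM2r// exprn_ge0// divr_ge0.
apply: is_cvg_geometric_series; rewrite ger0_norm; last exact: divr_ge0.
by rewrite ltr_pdivrMr ?mul1r//; case/andP: K01.
Qed.

Lemma power_sum_nonzero (a : nat -> C R) f z : is_power_sum_on_disc a f ->
  cmod z < 1 -> f z != 0 -> exists n, 0 < cmod (a n).
Proof.
move=> af z1 fz; apply: contrapT => /forallNP a0.
have {}a0 n : a n = 0.
  apply: cmod_eq0; apply/eqP; rewrite eq_le cmod_ge0 andbT leNgt.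
  exact/negP/a0.
move/negP: fz; apply; apply/eqP/cmod_eq0/eqP.
rewrite eq_le cmod_ge0 andbT; apply/ler_addgt0Pr => e e0.
have [N HN] := cvg_cmod (af _ z1) e0; have := HN N (leqnn _).
rewrite /power_series /series/= big1 ?subr0; last by move=> i _; rewrite a0 mul0r.
by rewrite add0r => /ltW.
Qed.

Lemma cmod_exprB z w n : cmod z <= 1 -> cmod w <= 1 ->
  cmod (z ^+ n - w ^+ n) <= n%:R * cmod (z - w).
Proof.
move=> z1 w1; elim: n => [|n IH]; first by rewrite !expr0 subrr cmod0 mul0r.
have -> : z ^+ n.+1 - w ^+ n.+1 = z * (z ^+ n - w ^+ n) + (z - w) * w ^+ n.
  by rewrite !exprS; ring.
apply: le_trans (cmodD _ _) _; rewrite !cmodM -natr1 mulrDl mul1r.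
have h1 : cmod z * cmod (z ^+ n - w ^+ n) <= n%:R * cmod (z - w).
  by apply: le_trans IH; rewrite ler_piMl ?cmod_ge0.
have h2 : cmod (z - w) * cmod (w ^+ n) <= cmod (z - w).
  by rewrite ler_piMr ?cmod_ge0// cmodX exprn_ile1 ?cmod_ge0.
exact: lerD.
Qed.

(** A grid square of side 1/n coded by two digits in base 2n + 1; a coordinate in [-1, 1] gives a
    digit from 0 to 2n, the last one at the coordinate 1. *)
Definition disc_cell (n : nat) w : nat :=
  (Num.truncn ((re w + 1) * n%:R) * (2 * n).+1 + Num.truncn ((im w + 1) * n%:R))%N.

(* Chosen representative of the q-th grid cell meeting the unit disc
   (0 when there is none). *)
Definition disc_net (n q : nat) : C R :=
  xget 0 [set w | cmod w <= 1 /\ disc_cell n w = q].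

Lemma cmod_disc_net n q : cmod (disc_net n q) <= 1.
Proof.
rewrite /disc_net; case: xgetP => [w _ []//|_].
by rewrite cmod0.
Qed.

Let trunc_lt (n : nat) (x : R) : `|x| <= 1 -> (Num.truncn ((x + 1) * n%:R) < (2 * n).+1)%N.
Proof.
rewrite ler_norml => /andP[x1 x2].
rewrite truncn_lt_nat; last by rewrite mulr_ge0//; lra.
rewrite -natr1 natrM ltr_pwDr// ler_wpM2r//; lra.
Qed.

Let trunc_eq (n : nat) (x y : R) : (0 < n)%N -> `|x| <= 1 -> `|y| <= 1 ->
  Num.truncn ((x + 1) * n%:R) = Num.truncn ((y + 1) * n%:R) ->
  `|x - y| <= n%:R^-1.
Proof.
move=> n0; rewrite !ler_norml => /andP[x1 x2] /andP[y1 y2] e.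
have n0' : 0 < n%:R :> R by rewrite ltr0n.
have hx : 0 <= (x + 1) * n%:R by rewrite mulr_ge0//; lra.
have hy : 0 <= (y + 1) * n%:R by rewrite mulr_ge0//; lra.
have /andP[a1 a2] := truncn_itv hx; have /andP[b1 b2] := truncn_itv hy.
rewrite e -natr1 in a1 a2; rewrite -natr1 in b2.
have -> : n%:R^-1 = 1 / n%:R :> R by rewrite div1r.
rewrite -mulNr ler_pdivrMr// ler_pdivlMr// !mulrBl.
move: a1 a2 b1 b2; rewrite !mulrDl !mul1r; lra.
Qed.

Lemma disc_netP n w : (0 < n)%N -> cmod w <= 1 ->
  (disc_cell n w < (2 * n).+1 ^ 2)%N /\
  cmod (w - disc_net n (disc_cell n w)) <= 2 / n%:R.
Proof.
move=> n0 w1; have [rw iw] := re_im_le w.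
have lr := trunc_lt n (le_trans rw w1); have li := trunc_lt n (le_trans iw w1).
split.
  rewrite /disc_cell -mulnn.
  apply: (@leq_trans ((Num.truncn ((re w + 1) * n%:R)).+1 * (2 * n).+1)%N).
    by rewrite (mulSnr (Num.truncn _)) ltn_add2l.
  by rewrite leq_mul2r lr orbT.
rewrite {1}/disc_net; case: xgetP => [v _ [v1 vw]|/(_ w)]; last by case.
have [rv iv] := re_im_le v.
have lrv := trunc_lt n (le_trans rv v1); have liv := trunc_lt n (le_trans iv v1).
apply: le_trans (cmod_le_re_im _) _; rewrite reB imB.
have -> : 2 / n%:R = n%:R^-1 + n%:R^-1 :> R by ring.
apply: lerD; apply: trunc_eq => //; try exact: le_trans w1; try exact: le_trans v1.
  (* Quotient and remainder by 2n + 1 recover the digits, so w and v agree up to 1/n in each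
     coordinate. *)
  have := congr1 (divn^~ (2 * n).+1) vw; rewrite /disc_cell !divnMDl//.
  by rewrite !divn_small// !addn0.
have := congr1 (modn^~ (2 * n).+1) vw; rewrite /disc_cell !modnMDl.
by rewrite !modn_small.
Qed.

End modulus.

(** Upper bounds on the real part after these four rotations bound a complex modulus, so one-sided
    estimates of real cosine sums suffice. *)
Definition quarter_turn (R : realType) (l : nat) : C R :=
  match l with
  | 0 => 1 | 1 => -1 | 2 => Complex 0 1 | _ => - (Complex 0 1 : C R)
  end.

Lemma cmod_quarter_turn (R : realType) l : cmod (quarter_turn R l) = 1.
Proof.
have i1 : cmod (Complex 0 1 : C R) = 1.
  by rewrite cmod_def /re /im /= expr0n expr1n add0r sqrtr1.
case: l => [|[|[|l]]].
- exact: cmod1.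
- exact: etrans (cmodN _) (cmod1 R).
- exact: i1.
- exact: etrans (cmodN _) i1.
Qed.

Lemma cmod_le_quarter_turns (R : realType) (S : C R) (y : R) :
  (forall l, (l < 4)%N -> re (quarter_turn R l * S) <= y) -> cmod S <= 2 * y.
Proof.
move=> Sy; apply: le_trans (cmod_le_re_im S) _.
have := Sy 0%N isT; have := Sy 1%N isT; have := Sy 2%N isT; have := Sy 3%N isT.
rewrite /= !reM /re /im /= => h3 h2 h1 h0.
have a1 : `|complex.Re (S : R[i])| <= y by rewrite ler_norml; lra.
have a2 : `|complex.Im (S : R[i])| <= y by rewrite ler_norml; lra.
lra.
Qed.

(** * Reduction of the maximum modulus to finitely many trigonometric sums *)

Section discretization.
Variables (R : realType) (a : nat -> C R) (theta : nat -> nat) (k : nat).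
Hypothesis k_gt0 : (0 < k)%N.

(** Counts triples (cell q, rotation l, residue m), coded as j = (q * 4 + l) * k + m; the
    definitions below decode j by division. *)
Definition disc_index (n : nat) : nat := ((2 * n).+1 ^ 2 * 4 * k)%N.
Definition residue_class (n j : nat) : pred nat := fun i => (i %% k == j %% k)%N.
Definition disc_coef (n j i : nat) : C R :=
  quarter_turn R (j %/ k %% 4) * (a i * disc_net R n (j %/ k %/ 4) ^+ i).
(** The signs come from Re((x + iy) e^(is)) = x cos s - y sin s. *)
Definition cos_coef n j i : R := re (disc_coef n j i).
Definition sin_coef n j i : R := - im (disc_coef n j i).

Lemma disc_index_gt0 n : (0 < disc_index n)%N.
Proof. by rewrite /disc_index 2!muln_gt0 expn_gt0 k_gt0. Qed.

Lemma disc_coef_le n j i :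
  cos_coef n j i ^+ 2 + sin_coef n j i ^+ 2 <= cmod (a i) ^+ 2.
Proof.
rewrite /cos_coef /sin_coef sqrrN -sqr_cmod ler_pXn2r ?nnegrE ?cmod_ge0//.
rewrite !cmodM cmod_quarter_turn mul1r cmodX.
by rewrite ler_piMr ?cmod_ge0// exprn_ile1 ?cmod_ge0// cmod_disc_net.
Qed.

Let tw t i : C R := twist theta a t i.

Lemma trig_sum_disc_coef n j r t :
  trig_sum theta residue_class cos_coef sin_coef n j r t =
  re (quarter_turn R (j %/ k %% 4) * \sum_(i < n | residue_class n j i)
     tw t i * ((r%:C%C : C R) * disc_net R n (j %/ k %/ 4)) ^+ i).
Proof.
rewrite mulr_sumr re_sum; apply: eq_bigr => i _.
have -> : quarter_turn R (j %/ k %% 4) *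
     (tw t i * ((r%:C%C : C R) * disc_net R n (j %/ k %/ 4)) ^+ i) =
   ((r ^+ i)%:C%C : C R) * (disc_coef n j i * expi ((theta i)%:R * t)).
  rewrite /tw /twist /disc_coef exprMn rmorphXn/=; ring.
rewrite reM (reM (disc_coef n j i)) /cos_coef /sin_coef.
rewrite {1 4}/re {2}/im /=; ring.
Qed.

Hypothesis sc : summable_on_disc (fun n => cmod (a n)).

(** Three contributions: the tail beyond n costs g1 / n; moving to a net point within 2/n costs 2 g1
    / n, since x^i is i-Lipschitz on the disc; each of the k residue classes at the net point costs
    2y. *)
Lemma max_modulus_le n r t y : (0 < n)%N -> 0 < r < 1 ->
  (forall j, (j < disc_index n)%N ->
    trig_sum theta residue_class cos_coef sin_coef n j r t <= y) ->
  max_modulus (f_t theta a t) r <=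
    (2 * k)%:R * y + 3 * (psum (euler_op (fun n => cmod (a n))) r / n%:R).
Proof.
move=> n0 r01 Hy; set g1 := psum _ r.
have r0 : 0 < r by lra.
have n0' : 0 < n%:R :> R by rewrite ltr0n.
apply: ge_sup.
  have c0 : cmod (0 : C R) <= r by rewrite cmod0 ltW.
  by exists (cmod (f_t theta a t 0)); exists 0.
move=> _ [z /= zr <-].
(* Rescaling to the unit disc lets the same net serve every r. *)
pose w : C R := z * (r^-1)%:C%C.
have zE : z = (r%:C%C : C R) * w.
  by rewrite /w mulrCA -rmorphM/= mulfV ?gt_eqF// rmorph1 mulr1.
have w1 : cmod w <= 1.
  by rewrite cmodM cmod_real gtr0_norm ?invr_gt0// ler_pdivrMr// mul1r.
have [qlt qd] := disc_netP n0 w1.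
set q := disc_cell n w in qlt qd; set v := disc_net R n q in qd.
have cr i : cmod (tw t i) = cmod (a i) by rewrite cmodM cmod_expi mulr1.
pose F (x : C R) i := tw t i * ((r%:C%C : C R) * x) ^+ i.
have cF x i : cmod x <= 1 -> cmod (F x i) <= cmod (a i) * r ^+ i.
  move=> x1; rewrite cmodM cr cmodX cmodM cmod_real gtr0_norm//.
  rewrite ler_wpM2l ?cmod_ge0// lerXn2r ?nnegrE ?mulr_ge0 ?cmod_ge0 ?(ltW r0)//.
  by rewrite ler_piMr// ltW.
have class_le (m : 'I_k) : cmod (\sum_(i < n | (i %% k == m)%N) F v i) <= 2 * y.
  apply: cmod_le_quarter_turns => l l4.
  pose j := ((q * 4 + l) * k + m)%N.
  have j1 : (j %/ k = q * 4 + l)%N by rewrite /j divnMDl// divn_small// addn0.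
  have j2 : (j %% k = m)%N by rewrite /j modnMDl modn_small.
  have jlt : (j < disc_index n)%N.
    rewrite /disc_index -(ltn_divLR _ _ k_gt0) j1.
    apply: (@leq_trans (q.+1 * 4)%N); first by rewrite mulSnr ltn_add2l.
    by rewrite leq_mul2r.
  have := Hy _ jlt; rewrite trig_sum_disc_coef /residue_class j1 j2.
  by rewrite divnMDl// divn_small// addn0 modnMDl modn_small.
have sum_v : cmod (\sum_(i < n) F v i) <= (2 * k)%:R * y.
  rewrite (partition_big (fun i : 'I_n => Ordinal (ltn_pmod i k_gt0)) predT)//=.
  apply: le_trans (cmod_sum _ _ _) _.
  apply: (@le_trans _ _ (\sum_(m < k) 2 * y)); last first.
    by rewrite sumr_const card_ord -[leLHS]mulr_natl natrM mulrA (mulrC k%:R).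
  by apply: ler_sum => m _; exact: class_le.
have diff : cmod (\sum_(i < n) (F w i - F v i)) <= 2 * (g1 / n%:R).
  apply: le_trans (cmod_sum _ _ _) _.
  apply: (@le_trans _ _ (\sum_(0 <= i < n) (euler_op (fun n => cmod (a n)) i * r ^+ i) * (2 / n%:R))).
    rewrite big_mkord; apply: ler_sum => i _.
    have -> : F w i - F v i = tw t i * ((r%:C%C : C R) ^+ i * (w ^+ i - v ^+ i)).
      by rewrite /F !exprMn; ring.
    rewrite (cmodM (tw t i)) cr (cmodM (_ ^+ i)) cmodX cmod_real gtr0_norm//.
    rewrite /euler_op [leRHS](_ : _ = cmod (a i) * (r ^+ i * (i%:R * (2 / n%:R))));
      last by ring.
    apply: ler_wpM2l; first exact: cmod_ge0.
    apply: ler_wpM2l; first by rewrite exprn_ge0// ltW.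
    apply: le_trans (cmod_exprB _ w1 (cmod_disc_net _ _ _)) _.
    by rewrite ler_wpM2l.
  rewrite -mulr_suml mulrC -mulrA (mulrC _^-1); apply: ler_wpM2l => //.
  apply: ler_wpM2r; first by rewrite invr_ge0 ltW.
  exact: (pseries_le_psum n (summable_euler_op sc) r01).
(* It is enough to bound the partial sums of length M >= n. *)
apply: (@cmod_limn_le _ _ _ n) => M nM.
have -> : power_series (twist theta a t) z M =
    \sum_(n <= i < M) F w i + \sum_(i < n) (F w i - F v i) + \sum_(i < n) F v i.
  rewrite /power_series /series/= (big_cat_nat _ (n := n))//= sumrB addrCA addrC.
  rewrite -addrA subrK big_mkord addrC; congr (_ + _); apply: eq_bigr => i _;
    by rewrite /F -zE.
have tail : cmod (\sum_(n <= i < M) F w i) <= g1 / n%:R.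
  apply: le_trans (cmod_sum _ _ _) _.
  apply: le_trans (pseries_tail_le M sc r01 n0).
  by apply: ler_sum => i _; exact: cF.
apply: le_trans (cmodD _ _) _; apply: le_trans (lerD (cmodD _ _) (lexx _)) _.
lra.
Qed.

End discretization.

(** * Combining the estimates *)

Lemma powR_expR (R : realType) (a x : R) : 0 < a -> a `^ x = expR (x * ln a).
Proof. by move=> a0; rewrite /powR gt_eqF. Qed.

Lemma ln_le_id (R : realType) (x : R) : 0 < x -> ln x <= x.
Proof. by move=> x0; exact: ltW (ln_sublinear x0). Qed.

Lemma ln_le_expR (R : realType) (x y : R) : 0 < x -> x <= expR y -> ln x <= y.
Proof. by move=> x0 xy; rewrite -[y]expRK ler_ln ?posrE ?expR_gt0. Qed.

(** Logarithms of the bounds for A and V, where H = ln h and x is the logarithm of ln g plus a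
    constant. *)
Definition mean_exponent (R : realType) (eps H x : R) :=
  H + x + (1 + eps) * ln x.
Definition variance_exponent (R : realType) (eps H x : R) :=
  H + mean_exponent eps H x + 1 + (1 + eps) * (ln 5 + ln H + ln x).

Lemma mean_variance_expR (R : realType) (eps H x A V : R) :
  0 < eps <= 1 -> 1 <= H -> 1 <= x -> 0 <= A ->
  A <= expR H * (expR x * x `^ (1 + eps)) ->
  V <= expR H * ((A + expR 1) * ln (A + expR 1) `^ (1 + eps)) ->
  A <= expR (mean_exponent eps H x) /\ V <= expR (variance_exponent eps H x).
Proof.
move=> /andP[/ltW e0 e1] H1 x1 A0.
have eps_le u : 0 <= u -> 0 <= eps * u <= u.
  by move=> u0; rewrite mulr_ge0//= ler_piMl.
set TT := mean_exponent eps H x; have x0 : 0 < x by lra.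
have H0 : 0 < H by lra.
rewrite [x `^ _]powR_expR// -!expRD addrA -/(mean_exponent eps H x) -/TT => AT VA.
have y0 : 0 <= ln x by exact: ln_ge0.
have G0 : 0 <= ln H by exact: ln_ge0.
have /andP[ey0 ey1] := eps_le _ y0.
have yx := ln_le_id x0.
have T1 : 1 <= TT by rewrite /TT /mean_exponent mulrDl mul1r; lra.
have ex1 : 2 <= expR 1 :> R by have := expR_ge1Dx (1 : R); lra.
have Ae : A + expR 1 <= expR (TT + 1).
  have : expR 1 <= expR (TT) by rewrite ler_expR.
  rewrite expRD; have := expR_gt0 (TT); nra.
have Ae0 : 0 < A + expR 1 by lra.
(* The exponent TT + 1 is at most H + 3x + 1, and H, x >= 1; this is the source of the ln 5 in
   [variance_exponent]. *)
have l1 : ln (A + expR 1) <= 5 * (H * x).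
  apply: (@le_trans _ _ (TT + 1)); first exact: ln_le_expR.
  rewrite /TT /mean_exponent mulrDl mul1r; nra.
have l0 : 1 <= ln (A + expR 1).
  by rewrite -[leLHS]expRK ler_ln ?posrE ?expR_gt0// lerDr.
have l0' : 0 < ln (A + expR 1) by lra.
split=> //; apply: (le_trans VA).
have -> : variance_exponent eps H x = H + ((TT + 1) + (1 + eps) * (ln 5 + ln H + ln x)).
  by rewrite /variance_exponent -/TT; ring.
rewrite expRD ler_pM2l ?expR_gt0// expRD.
apply: ler_pM => //; [exact: ltW|exact: powR_ge0|].
rewrite powR_expR// ler_expR; apply: ler_wpM2l; first by rewrite addr_ge0.
rewrite -addrA -!lnM ?posrE ?mulr_gt0//.
by rewrite ler_ln ?posrE// !mulr_gt0//; lra.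
Qed.

(** From exp x >= 8 (x - 2), the term 5x/2 is at most (5/16) exp x + 5 and is absorbed on the left.
    With exp x in the role of ln g, this removes ln ln g from its own bound. *)
Lemma expR_le_linear (R : realType) (x Y H m C : R) : expR x <= Y + H + 5 / 2 * x + C ->
  H <= Y - m -> 2 * (C - m + 5) <= Y -> expR x <= 5 * Y.
Proof.
move=> h1 h2 h3; have h4 : 8 * (x - 2) <= expR x.
  have -> : expR x = expR (x - 3) * (expR 1 * expR 1 * expR 1).
    by rewrite -!expRD; congr expR; lra.
  have := expR_ge1Dx (1 : R); have := expR_ge1Dx (x - 3).
  have := expR_gt0 (x - 3); set u := expR (x - 3); set v := expR 1 => u0 h5 h6.
  have v8 : 8 <= v * v * v by nra.
  have [p|p] := leP 0 (x - 2); first by nra.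
  have : 0 <= u * (v * v * v) by rewrite !mulr_ge0 ?ltW//; lra.
  lra.
have := expR_gt0 x; lra.
Qed.

Lemma sqrt_expR (R : realType) (u : R) : Num.sqrt (expR u) = expR (u / 2).
Proof.
by rewrite {1}(splitr u) expRD -expr2 sqrtr_sqr ger0_norm ?expR_ge0.
Qed.

(** All quantities are compared through exponents. The variance bounds g in terms of ln ln g,
    [expR_le_linear] replaces the latter by ln ln(h mu), and the room between eps/4 and delta in the
    power of ln h absorbs the constants once h is large. *)
Lemma wiman_algebra (R : realType) (eps delta kap m0 : R) (k n0 : nat) :
  0 < eps <= 1 -> eps <= delta ->
  (0 < k)%N ->
  exists H0 : R, forall (h mu g A V : R) (n : nat),
    0 < h -> H0 <= ln h -> 0 < mu -> m0 <= ln mu -> mu <= g -> 0 <= A -> 0 <= V ->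
    expR 1 <= ln g + kap ->
    A <= h * ((ln g + kap) * ln (ln g + kap) `^ (1 + eps)) ->
    V <= h * ((A + expR 1) * ln (A + expR 1) `^ (1 + eps)) ->
    g <= 4 * mu * (Num.sqrt (2 * V + 2) + 1) ->
    12 * A * (Num.sqrt (2 * V + 2) + 1) <= n%:R ->
    (0 < n)%N ->
    n%:R <= 12 * A * (Num.sqrt (2 * V + 2) + 1) + n0%:R + 1 ->
    (2 * k)%:R * (3 * Num.sqrt (ln ((disc_index k n)%:R * h)) * Num.sqrt (mu * g))
      + 3 * (A * g / n%:R) <=
    mu * Num.sqrt h * ln (h * mu) `^ (1 / 4) * ln h `^ (3 / 4 + delta)
      * ln (ln (h * mu)) `^ (1 + delta).
Proof.
move=> eps01 ed k0; have d0 : 0 < delta by case/andP: eps01 => ? _; lra.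
have [e0 e1] : 0 <= eps /\ eps <= 1 by case/andP: eps01 => /ltW.
have eps_le u : 0 <= u -> 0 <= eps * u <= u.
  by move=> u0; rewrite mulr_ge0//= ler_piMl.
pose c5 : R := ln 5; pose c12 : R := ln 12.
have c5_0 : 0 <= c5 by rewrite ln_ge0//; lra.
have c5_5 : c5 <= 5 by apply: ln_le_id.
pose C0 := 1 / 2 + c5 + c12 + kap.
pose C1 := c12 + c5 / 2 + 1 / 2 + 2 + c5.
(* From n <= 36 e^B + n0 + 1 with B >= 0 one gets 2n + 1 <= (75 + 2 n0) e^B. *)
pose J0 : R := (75 + 2 * n0%:R) ^+ 2 * (4 * k%:R).
have k1 : 1 <= k%:R :> R by rewrite ler1n.
have n00 : 0 <= n0%:R :> R by [].
have J01 : 1 <= J0.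
  rewrite /J0; have : 1 <= (75 + 2 * n0%:R : R) ^+ 2 by rewrite expr2; nra.
  nra.
have cJ0 : 0 <= ln J0 by exact: ln_ge0.
pose C2 := ln J0 + 13 * c5 + 19.
have C2_0 : 0 < C2 by rewrite /C2; lra.
pose C3 := (ln C2 + C1) / 2.
have c12_0 : 0 <= c12 by rewrite ln_ge0//; lra.
have C3_0 : 0 <= C3.
  have : 0 <= ln C2 by rewrite ln_ge0// /C2; lra.
  rewrite /C3 /C1; lra.
pose C4 := C3 + ln (6 * k%:R + 1).
pose G0 := 4 * C4 / (3 * delta).
(* Collects the demands H >= 1, ln H >= G0, Y >= e^5 and Y >= 2 (C0 - m0 + 5); |m0| compensates for
   ln mu, which may be negative. *)
pose H0 := 1 + expR G0 + `|2 * (C0 - m0 + 5)| + expR 5 + `|m0|.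
exists H0 => h mu g A V n h0 Hh mu0 mmu mug A0 V0 F1 AF VF gV nA n0' nX.
set H := ln h in Hh *.
have hE : h = expR H by rewrite /H lnK.
set Lm := ln mu in mmu.
have muE : mu = expR Lm by rewrite /Lm lnK.
pose Y := H + Lm.
have YE : ln (h * mu) = Y by rewrite lnM ?posrE.
have a1 := normr_ge0 (2 * (C0 - m0 + 5)); have a2 := ler_norm (2 * (C0 - m0 + 5)).
have a3 := normr_ge0 m0; have a4 := ler_norm (- m0); rewrite normrN in a4.
have a5 := expR_gt0 (5 : R); have a6 := expR_gt0 G0.
rewrite /H0 in Hh.
have H1 : 1 <= H by clear -Hh a1 a3 a5 a6; lra.
have GG0 : G0 <= ln H.
  rewrite -[leLHS]expRK ler_ln ?posrE//; clear -Hh a1 a3 a5 a6 H1; lra.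
have HY : H <= Y - m0 by rewrite /Y; clear -mmu; lra.
have Y5 : expR 5 <= Y by rewrite /Y; clear -Hh a1 a4 a5 a6 mmu; lra.
have YC : 2 * (C0 - m0 + 5) <= Y.
  by rewrite /Y; clear -Hh a2 a4 a5 a6 mmu; lra.
have Y0 : 0 < Y by clear -Y5 a5; lra.
set Z := ln Y.
have Z5 : 5 <= Z by rewrite -[leLHS]expRK ler_ln ?posrE.
have Z0 : 0 < Z by clear -Z5; lra.
set z := ln Z; have z0 : 0 <= z by apply: ln_ge0; clear -Z5; lra.
set F := ln g + kap in F1 AF *.
have F0 : 0 < F by apply: lt_le_trans F1; exact: expR_gt0.
pose x := ln F.
have FE : F = expR x by rewrite /x lnK.
have x1 : 1 <= x by rewrite -[leLHS]expRK ler_ln ?posrE ?expR_gt0.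
have x0 : 0 < x := lt_le_trans ltr01 x1.
have g0 : 0 < g := lt_le_trans mu0 mug.
have Hgt0 : 0 < H := lt_le_trans ltr01 H1.
set G := ln H in GG0; have G0' : 0 <= G by apply: ln_ge0.
have GH : G <= H by exact: ln_le_id.
set y := ln x; have y0 : 0 <= y by apply: ln_ge0.
have yx : y <= x by exact: ln_le_id.
rewrite -/x hE {1}FE in AF; rewrite hE in VF.
have [AT VW] := mean_variance_expR eps01 H1 x1 A0 AF VF.
set tt := mean_exponent eps H x in AT *; set ww := variance_exponent eps H x in VW *.
have ttE : tt = H + x + (1 + eps) * y by [].
have wwE : ww = H + tt + 1 + (1 + eps) * (c5 + G + y) by [].
have /andP[ey0 ey1] := eps_le _ y0.
have /andP[eG0 eG1] := eps_le _ G0'.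
have /andP[ec0 ec1] := eps_le _ c5_0.
have /andP[ez0 ez1] := eps_le _ z0.
have tt_le : tt <= H + 3 * x by rewrite ttE mulrDl mul1r; clear -yx ey1; lra.
have ww_le : ww <= 4 * H + 5 * x + 1 + 2 * c5.
  by rewrite wwE mulrDl mul1r !mulrDr; clear -tt_le GH yx ey1 eG1 ec1; lra.
have tt0 : 0 <= tt.
  by rewrite ttE mulrDl mul1r; clear -H1 x1 y0 ey0; lra.
have ww0 : 0 <= ww.
  rewrite wwE mulrDl mul1r !mulrDr; clear -tt0 H1 c5_0 G0' y0 ec0 eG0 ey0; lra.
have ew1 : 1 <= expR (ww / 2) by have := expR_ge1Dx (ww / 2); clear -ww0; lra.
set s := Num.sqrt (2 * V + 2) in gV nA nX *.
have s0 : 0 <= s by exact: sqrtr_ge0.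
have s_le : s + 1 <= 3 * expR (ww / 2).
  suff : s <= 2 * expR (ww / 2) by clear -ew1; lra.
  have -> : 2 * expR (ww / 2) = Num.sqrt (4 * expR ww).
    rewrite sqrtrM// sqrt_expR (_ : 4 = 2 ^+ 2); last by clear; ring.
    by rewrite sqrtr_sqr ger0_norm.
  rewrite ler_sqrt; last by rewrite mulr_ge0// expR_ge0.
  have := expR_ge1Dx ww.
  clear -VW ww0; lra.
have g_le : g <= expR (c12 + Lm + ww / 2).
  rewrite !expRD lnK ?posrE//.
  rewrite -muE; apply: (le_trans gV).
  have := ler_wpM2l (ltW mu0) s_le; clear; lra.
have lg : ln g <= c12 + Lm + ww / 2 by exact: ln_le_expR.
(* Bootstrap: the bound on ln g involves x = ln F only linearly, while F = exp x. *)
have xY : expR x <= 5 * Y.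
  apply: (@expR_le_linear _ x Y H m0 C0) => //.
  rewrite -FE /F /C0 /Y; move: lg; rewrite wwE ttE !mulrDl !mul1r !mulrDr.
  clear -GH G0' yx ey1 eG1 ec1 ec0 eG0 c5_0; lra.
have xZ : x <= c5 + Z.
  rewrite /c5 /Z -lnM ?posrE//.
  rewrite -[leLHS]expRK ler_ln ?posrE ?expR_gt0//; clear -Y0; lra.
(* Since Z >= 5, x <= ln 5 + Z <= 2 Z <= e Z. *)
have yz : y <= 1 + z.
  have e2 : 2 <= expR 1 :> R by clear; have := expR_ge1Dx (1 : R); lra.
  rewrite /y /z -{1}[1]expRK -lnM ?posrE ?expR_gt0//.
  rewrite ler_ln ?posrE ?mulr_gt0 ?expR_gt0//.
  clear -xZ e2 c5_5 Z5 Z0; nra.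
have eyz : eps * y <= eps + eps * z.
  by have := ler_wpM2l e0 yz; rewrite mulrDr mulr1.
(* That is, g <= mu h sqrt(ln(h mu)) up to powers of ln h and ln ln(h mu). *)
pose LB := Lm + H + Z / 2 + (1 + eps) * G / 2 + (1 + eps) * z + C1.
have gLB : g <= expR LB.
  apply: (le_trans g_le); rewrite ler_expR /LB /C1 wwE ttE !mulrDl !mul1r !mulrDr.
  clear -yz eyz xZ c5_0 ec1 ec0 z0 e1; move: e1; lra.
(* The net has polynomial size in h and ln(h mu), so the union bound costs only ln h * ln ln(h
   mu). *)
have jump : ln ((disc_index k n)%:R * h) <= C2 * (H * Z).
  have nn0 : 0 <= n%:R :> R by [].
  pose B := tt + ww / 2.
  have B1 : 1 <= expR B by have := expR_ge1Dx B; rewrite {1}/B; clear -tt0 ww0; lra.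
  have As : 12 * A * (s + 1) <= 36 * expR B.
    have : A * (s + 1) <= expR tt * (3 * expR (ww / 2)).
      by apply: ler_pM => //; clear -s0; lra.
    rewrite /B expRD; clear; lra.
  have n2 : (2 * n).+1%:R <= (75 + 2 * n0%:R) * expR B.
    rewrite -natr1 natrM.
    have : n0%:R <= n0%:R * expR B by rewrite ler_peMr.
    clear -nX As B1; lra.
  have Jle : (disc_index k n)%:R * h <= J0 * expR (2 * B + H).
    have -> : (disc_index k n)%:R = (2 * n).+1%:R ^+ 2 * 4 * k%:R :> R.
      by rewrite /disc_index natrM natrM natrX.
    rewrite expRD -hE mulrA ler_pM2r//.
    rewrite /J0 (_ : expR (2 * B) = expR B ^+ 2); last by rewrite -expRM_natl.
    rewrite -[leLHS]mulrA.
    rewrite [leRHS](_ : _ = ((75 + 2 * n0%:R) * expR B) ^+ 2 * (4 * k%:R)); last by clear; ring.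
    apply: ler_wpM2r; first by rewrite mulr_ge0.
    by rewrite lerXn2r// nnegrE// mulr_ge0 ?expR_ge0// addr_ge0 ?mulr_ge0.
  have Jpos : 0 < (disc_index k n)%:R * h.
    by rewrite mulr_gt0// ltr0n disc_index_gt0.
  have : ln ((disc_index k n)%:R * h) <= ln J0 + (2 * B + H).
    apply: ln_le_expR => //; rewrite expRD lnK ?posrE//; clear -J01; lra.
  move=> /le_trans; apply.
  have h1 : 1 <= H * Z by clear -H1 Z5; nra.
  have h2 : H <= H * Z by rewrite ler_peMr//; clear -Hgt0 Z5; lra.
  have h3 : Z <= H * Z by rewrite ler_peMl//; clear -Z0; lra.
  pose u := ln J0 + 13 * c5 + 1.
  have h4 : u <= u * (H * Z).
    by rewrite ler_peMr//; rewrite /u; clear -cJ0 c5_0; lra.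
  have -> : C2 * (H * Z) = u * (H * Z) + 18 * (H * Z) by rewrite /C2 /u; clear; ring.
  have h5 : ln J0 + (2 * B + H) <= u + 7 * H + 11 * Z.
    by rewrite /u /B; clear -tt_le ww_le xZ; lra.
  by clear -h2 h3 h4 h5; lra.
pose E := expR (Lm + H / 2 + Z / 4 + (3 / 4 + eps / 4) * G + (1 + eps / 2) * z + C3).
have part1 : Num.sqrt (ln ((disc_index k n)%:R * h)) * Num.sqrt (mu * g) <= E.
  have -> : E = Num.sqrt (expR (ln C2 + G + z)) * Num.sqrt (expR (Lm + LB)).
    rewrite !sqrt_expR -expRD /E; congr expR; rewrite /LB /C3; clear; by field.
  apply: ler_pM; rewrite ?sqrtr_ge0// ler_sqrt ?expR_ge0//.
    by rewrite !expRD !lnK ?posrE// -mulrA.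
  by rewrite expRD -muE ler_pM2l.
(* The 12 in the choice of n is the 3 here times the 4 in the Chebyshev bound on g. *)
have part2 : 3 * (A * g / n%:R) <= mu.
  rewrite mulrA ler_pdivrMr ?ltr0n//.
  have := ler_wpM2l A0 gV; have := ler_wpM2l (ltW mu0) nA; clear; lra.
have part3 : mu <= E.
  rewrite muE ler_expR.
  have : 0 <= (3 / 4 + eps / 4) * G by rewrite mulr_ge0//; clear -e0; move: e0; lra.
  have : 0 <= (1 + eps / 2) * z by rewrite mulr_ge0//; clear -e0; move: e0; lra.
  clear -Hgt0 Z0 C3_0; lra.
apply: (@le_trans _ _ ((6 * k%:R + 1) * E)).
  have kk : 0 <= 6 * k%:R :> R by rewrite mulr_ge0.
  have := ler_wpM2l kk part1; rewrite natrM; clear -part2 part3; lra.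
rewrite YE -/G -/Z -/z (powR_expR _ Y0) (powR_expR _ Hgt0) (powR_expR _ Z0).
rewrite -/G -/Z -/z hE muE sqrt_expR -[6 * _ + 1]lnK ?posrE; last by clear -k1; lra.
rewrite -!expRD ler_expR.
(* The target exceeds E by at least (delta - eps/4) G >= (3/4) delta G in the exponent. *)
have C4G : C4 <= 3 / 4 * delta * G.
  have := ler_wpM2l (ltW d0) GG0; rewrite /G0 => hh.
  have -> : C4 = 3 / 4 * (delta * (4 * C4 / (3 * delta))).
    by clear -d0; field; rewrite gt_eqF.
  clear -hh; lra.
have edG : eps * G <= delta * G by rewrite ler_wpM2r.
have edz : eps * z <= delta * z by rewrite ler_wpM2r.
move: C4G; rewrite /C4 !mulrDl !mul1r; clear -edG edz ez0 eG0; lra.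
Qed.

(** Bernoulli gives q^k >= 2 once k >= 1 / (q - 1), and distinct congruent indices differ by at
    least k. *)
Lemma lacunary_expn (R : realType) (theta : nat -> nat) (q : R) :
  (forall n, (0 < theta n)%N) -> 1 < q ->
  (forall n, q <= (theta n.+1)%:R / (theta n)%:R) ->
  exists2 k, (0 < k)%N & forall i l : nat,
    (i %% k = l %% k)%N -> (i < l)%N -> (2 * theta i <= theta l)%N.
Proof.
move=> th0 q1 thq.
have thS n : q * (theta n)%:R <= (theta n.+1)%:R.
  by rewrite -ler_pdivlMr ?ltr0n.
have thD m i : q ^+ m * (theta i)%:R <= (theta (i + m)%N)%:R.
  elim: m => [|m IH]; first by rewrite expr0 mul1r addn0.
  rewrite addnS exprS -mulrA; apply: le_trans (thS _).
  by rewrite ler_wpM2l//; lra.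
pose k := (Num.truncn (q - 1)^-1).+1; exists k => // i l ik il.
have qk : 2 <= q ^+ k.
  have qm0 : 0 < q - 1 by lra.
  have := bernoulli_le k (ltW qm0); rewrite (_ : 1 + (q - 1) = q); last by ring.
  apply: le_trans; rewrite -lerBlDl (_ : 2 - 1 = 1); last by ring.
  by rewrite -ler_pdivrMr// div1r ltW// truncnS_gt.
have kl : (k <= l - i)%N.
  apply: dvdn_leq; first by rewrite subn_gt0.
  by rewrite -eqn_mod_dvd ?(ltnW il)//; apply/eqP.
rewrite -(ler_nat R) natrM -(subnKC (ltnW il)).
apply: le_trans (thD _ _); rewrite ler_wpM2r//; apply: (le_trans qk).
by rewrite ler_weXn2l// ltW.
Qed.

Section max_term_theory.
Variables (R : realType) (a : nat -> C R).
Let c n := cmod (a n).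
Hypothesis sc : summable_on_disc c.
Variable r : R.
Hypothesis r01 : 0 < r < 1.

Lemma le_max_term n : c n * r ^+ n <= max_term a r.
Proof.
apply: ub_le_sup; last by exists n.
by exists (psum c r) => _ [m _ <-]; exact: psum_term_le.
Qed.

Lemma max_term_le_psum : max_term a r <= psum c r.
Proof.
apply: ge_sup; first by exists (c 0 * r ^+ 0); exists 0%N.
by move=> _ [m _ <-]; exact: psum_term_le.
Qed.

(** In each square one factor is bounded by the maximal term. *)
Lemma sqsum_le n : sqsum c n r <= max_term a r * psum c r.
Proof.
have r0 : 0 <= r by rewrite ltW//; case/andP: r01.
have cr0 i : 0 <= c i * r ^+ i by rewrite mulr_ge0 ?sc.1// exprn_ge0.
have mu0 := le_trans (cr0 0%N) (le_max_term 0%N).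
apply: (@le_trans _ _ (max_term a r * pseries c r n)); last first.
  by rewrite ler_wpM2l// pseries_le_psum.
rewrite /pseries /series/= big_mkord mulr_sumr; apply: ler_sum => i _.
rewrite mulrC expr2; apply: ler_wpM2r => //; exact: le_max_term.
Qed.

End max_term_theory.

Theorem theorem3p1 (R : realType) (h : R -> R) (f : C R -> C R)
    (a : nat -> C R) (theta : nat -> nat) (q : R) :
  classH h ->
  is_power_sum_on_disc a f ->
  (exists2 z, cmod z < 1 & f z != 0) ->
  (forall n, (0 < theta n)%N) ->
  1 < q ->
  (forall n, q <= (theta n.+1)%:R / (theta n)%:R) ->
  forall delta : R, 0 < delta ->
  {ae lebesgue_measure, forall t : R,
    exists E : set R,
      [/\ measurable E,
          E `<=` `]0, 1[,
          (\int[lebesgue_measure]_(r in E) (h r)%:E < +oo)%E &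
          forall r, 0 < r < 1 -> ~ E r ->
            max_modulus (f_t theta a t) r <=
            wiman_bound h (max_term a) delta r]}.
Proof.
move=> [hpos hcont hmono hinf _] af [z0 z01 fz0] th0 q1 thq delta d0.
pose c n := cmod (a n).
have sc : summable_on_disc c := power_sum_summable af.
have [n1 cn1] := power_sum_nonzero af z01 fz0.
have mh : measurable_fun (`]0, 1[ : set R) h.
  by apply: subspace_continuous_measurable_fun => //; exact: measurable_itv.
have g_gt0 r : 0 < r < 1 -> 0 < psum c r.
  move=> r01; apply: lt_le_trans (psum_term_le n1 sc r01).
  by rewrite mulr_gt0// exprn_gt0//; case/andP: r01.
have [k k0 thk] := lacunary_expn th0 q1 thq.
pose eps := Num.min delta 1.
have eps01 : 0 < eps <= 1 by rewrite lt_min d0 ltr01 ge_min lexx orbT.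
have epsd : eps <= delta by rewrite ge_min lexx.
have eps0 : 0 < eps by case/andP: eps01.
have [E1 fE1 HE1] := mean_variance_except mh hpos sc eps0 g_gt0.
(* One nonzero coefficient bounds ln mu from below for all r > 1/2. *)
pose m0 := ln (c n1 * 2^-1 ^+ n1).
have [H0 HH0] := wiman_algebra (expR 1 - ln (psum c 2^-1)) m0 n1 eps01 epsd k0.
pose s r := Num.sqrt (2 * pvar c r + 2).
(* The truncation index is the integer part of X: the first term makes the discretization error at
   most mu, and n1 + 1 keeps the nonzero term n1 in the sum, so that sqsum > 0. *)
pose X r := 12 * pmean c r * (s r + 1) + n1%:R + 1.
pose M := expR (Num.max H0 1).
have [r1 [r1h r11 Mr1]] : exists r1 : R, [/\ 2^-1 < r1, r1 < 1 & M <= h r1].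
  have n1' : \forall r \near 1^'-, M <= h r by move/cvgryPge : hinf; exact.
  have n2 : \forall r \near (1 : R)^'-, r < 1 by exact: nbhs_left_lt.
  have n3 : \forall r \near (1 : R)^'-, 2^-1 < r by apply: nbhs_left_gt; lra.
  by have [r [[? ?] ?]] := filter_ex (filterI (filterI n3 n2) n1'); exists r.
pose D : set R := `]r1, 1[%classic.
have mD : measurable D by exact: measurable_itv.
have DE r : D r -> r1 < r < 1 by rewrite /D/= in_itv.
have D01 : D `<=` `]0, 1[.
  by move=> r /DE r1r; rewrite /= in_itv/=; lra.
have D01' r : D r -> 0 < r < 1 by move=> /DE; lra.
have hM r : D r -> M <= h r.
  by move=> /DE r1r; apply: (le_trans Mr1); apply: hmono; lra.
have mX : measurable_fun D X.
  apply: open_continuous_measurable_fun; first exact: interval_open.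
  move=> r /set_mem /D01' r01.
  have cm := continuous_pmean sc g_gt0 r01; have cv := continuous_pvar sc g_gt0 r01.
  apply: cvgD; last exact: cvg_cst.
  apply: cvgD; last exact: cvg_cst.
  apply: cvgM; first by apply: cvgM => //; exact: cvg_cst.
  apply: cvgD; last exact: cvg_cst.
  have c2 : (2 * pvar c x + 2) @[x --> r] --> 2 * pvar c r + 2.
    apply: cvgD; last exact: cvg_cst.
    by apply: cvgM => //; exact: cvg_cst.
  exact: (cvg_comp _ _ c2 (@sqrt_continuous R (2 * pvar c r + 2))).
have mhD : measurable_fun D h by exact: measurable_funS mh.
(* Extension by 0 off D gives functions measurable on the whole line, as Tonelli's argument
   needs. *)
pose h' := h \_ D; pose X' := X \_ D.
have mh' : measurable_fun setT h' by apply/(measurable_restrictT _ _).1.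
have mX' : measurable_fun setT X' by apply/(measurable_restrictT _ _).1.
have h'E r : D r -> h' r = h r by move=> Dr; rewrite /h' patchE mem_set.
have X'E r : D r -> X' r = X r by move=> Dr; rewrite /X' patchE mem_set.
have M1 : 1 < M.
  by rewrite /M expR_gt1 lt_max ltr01 orbT.
have h'1 r : D r -> 1 < h' r.
  by move=> Dr; rewrite h'E//; apply: lt_le_trans (hM _ Dr).
have A0 r : D r -> 0 <= 12 * pmean c r * (s r + 1).
  move=> /D01' r01; rewrite mulr_ge0 ?addr_ge0 ?sqrtr_ge0//.
  by rewrite mulr_ge0// pmean_ge0.
have Nlarge r : D r -> (n1 < Num.truncn (X' r))%N.
  move=> Dr; rewrite X'E// truncn_gt_nat /X -[leLHS]natr1.
  have := A0 _ Dr; lra.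
have sq0 r : D r -> 0 < sqsum c (Num.truncn (X' r)) r.
  move=> Dr; rewrite /sqsum (bigD1 (Ordinal (Nlarge _ Dr)))//=.
  rewrite ltr_pwDl// ?sumr_ge0// => [|i _]; last exact: sqr_ge0.
  by rewrite exprn_gt0// mulr_gt0// exprn_gt0//; case/andP: (D01' _ Dr).
have J0 n : (0 < disc_index k n)%N by exact: disc_index_gt0.
have ae_t := trig_sum_ae_bound mh' mX' mD D01 h'1 th0
  (P := residue_class k) (fun n j i l Pi Pl => thk i l (etrans (eqP Pi) (esym (eqP Pl))))
  (fun i => cmod_ge0 (a i)) (@disc_coef_le R a k) J0 sq0.
move: ae_t; apply: (@filterS _ _ (ae_filter_ringOfSetsType lebesgue_measure)) => t [E2 [E2D [mE2 E201 fE2] HE2]].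
have {}fE2 : finite_integral_on h E2.
  split=> //; apply: le_lt_trans fE2; rewrite le_eqVlt; apply/orP; left; apply/eqP.
  by apply: eq_integral => r /set_mem /E2D Dr; rewrite h'E.
(* The radii up to r1, where h may be too small for the estimates, have finite h-measure and are
   discarded. *)
have fE3 : finite_integral_on h `]0, r1] by exact: finite_integral_on_itv.
have [mE E01 fE] := finite_integral_on_setU mh hpos fE3
  (finite_integral_on_setU mh hpos fE1 fE2).
exists (`]0, r1] `|` (E1 `|` E2)); split => // r r01 nE.
have r1r : r1 < r.
  rewrite ltNge; apply/negP => rr1; apply: nE; left.
  by rewrite /= in_itv/= rr1 andbT; case/andP: r01.
have Dr : D r by rewrite /D/= in_itv/= r1r; case/andP: r01.
have nE1 : ~ E1 r by move=> E1r; apply: nE; right; left.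
have nE2 : ~ E2 r by move=> E2r; apply: nE; right; right.
have r2r : 2^-1 < r < 1 by rewrite (lt_trans r1h)//; case/andP: r01.
have [Am Vm] := HE1 _ r2r nE1.
set n := Num.truncn (X' r).
have n_gt0 : (0 < n)%N by exact: leq_ltn_trans (Nlarge _ Dr).
set mu := max_term a r; set g := psum c r.
have g0 : 0 < g by exact: g_gt0.
have h0 : 0 < h r by exact: hpos.
have mu_n1 : c n1 * r ^+ n1 <= mu by exact: (le_max_term sc r01).
have c1pos : 0 < c n1 * 2^-1 ^+ n1 by rewrite mulr_gt0// exprn_gt0.
have c1mu : c n1 * 2^-1 ^+ n1 <= mu.
  apply: le_trans mu_n1; rewrite ler_wpM2l ?cmod_ge0// lerXn2r ?nnegrE//.
    by rewrite ltW//; case/andP: r01.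
  by rewrite ltW//; case/andP: r2r.
have mu0 : 0 < mu by exact: lt_le_trans c1mu.
have Xr := truncn_itv (_ : 0 <= X r).
have X0 : 0 <= X r by have := A0 _ Dr; rewrite /X; have := ler0n R n1; lra.
have /andP[Xn1 Xn2] := Xr X0; rewrite -(X'E _ Dr) -/n in Xn1 Xn2.
have key := max_modulus_le k0 sc n_gt0 r01 (HE2 r Dr nE2).
apply: (le_trans key).
rewrite h'E// -/n.
have alg := HH0 (h r) mu g (pmean c r) (pvar c r) n h0.
rewrite (_ : psum (euler_op (fun n => cmod (a n))) r = pmean c r * g); last first.
  by rewrite /pmean divfK// gt_eqF.
apply: (@le_trans _ _ ((2 * k)%:R * (3 * Num.sqrt (ln ((disc_index k n)%:R * h r))
    * Num.sqrt (mu * g)) + 3 * (pmean c r * g / n%:R))).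
  rewrite lerD2r; apply: ler_wpM2l => //; apply: ler_wpM2l.
    by rewrite mulr_ge0// sqrtr_ge0.
  by rewrite ler_wsqrtr//; exact: sqsum_le.
apply: alg.
- have := hM _ Dr; rewrite /M => Mh; rewrite -[leLHS]expRK ler_ln ?posrE ?expR_gt0//.
  by apply: le_trans Mh; rewrite ler_expR le_max lexx.
- exact: mu0.
- by rewrite ler_ln ?posrE.
- exact: max_term_le_psum.
- exact: pmean_ge0.
- exact: pvar_ge0.
- by apply: (log_psum_ge sc g_gt0); [rewrite ltW//; case/andP: r2r|case/andP: r01].
- exact: Am.
- exact: Vm.
- exact: psum_le_max_term (le_max_term sc r01).
- move: Xn2; rewrite X'E// /X -/(s r) -natr1; have := ler0n R n1; lra.
- exact: n_gt0.
- by move: Xn1; rewrite X'E.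
Qed.
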